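(* Let $X=\mathbf{R}/\mathbf{Z}$, $I=(0,1)$, and let $\varepsilon>0$ be a constant. Let $u^0,u^1\in C^\infty(X)$ satisfy the strict convexity condition $u^i_{xx}+1\ge\lambda$ on $X$ for $i=0,1$, where $\lambda>0$ is a constant. Let $u$ be the solution of $$u_{tt}(1+u_{xx})-u_{xt}^2=\varepsilon\quad\text{on }X\times I,$$ with $D^2_{xt}u+I_x\ge0$ and Dirichlet data $u(x,0)=u^0(x)$, $u(x,1)=u^1(x)$. Then for any non-negative integer $N$, there exist $M(N)$ and a constant $C_N$ depending only on $\lambda$ and the $C^{M(N)}$ norms of the Dirichlet data $u^0,u^1$ so that $$\sum_{a+b\le N}\|\partial_x^a\partial_t^bu\|_{C^0(X\times I)}\le C_N.$$ In particular, the constants $C_N$ are independent of $\varepsilon$.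
   Context: $D^2_{xt}u+I_x$ denotes the symmetric $2\times2$ matrix $\begin{pmatrix}u_{xx}+1 & u_{xt} \\ u_{xt} & u_{tt}\end{pmatrix}$, and $\ge0$ means positive semidefinite. Functions on the circle $X$ are regarded as $1$-periodic functions on $\mathbf{R}$.
   Formalization: The formal theorem assumes ε ≤ ε₀ for an arbitrary fixed ε₀, and C_N may depend on ε₀ (not on ε). Without an upper bound the claim is false: u⁰=u¹=0, u=ε(t²−t)/2 has sup|u|=ε/8, unbounded as ε→∞. *)

(* Defs.v *)
From Stdlib Require Import Reals.
From Coquelicot Require Import Coquelicot.
Open Scope R_scope.

(* Functions on the circle X = R/Z are 1-periodic functions on R.  Functions on
   X x [0,1] are functions R -> R -> R, first argument x and second argument t,
   1-periodic in x; their values for t outside [0,1] are junk and never used. *)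

Definition sup_norm {T : Type} (D : T -> Prop) (f : T -> R) : Rbar :=
  Lub_Rbar (fun r => exists p : T, D p /\ r = Rabs (f p)).

(* F 0 + ... + F n, both ends included.  It is only applied to sup norms over
   nonempty sets, so no -oo ever occurs. *)
Fixpoint Rbar_sum (F : nat -> Rbar) (n : nat) : Rbar :=
  match n with
  | O => F O
  | S m => Rbar_plus (Rbar_sum F m) (F (S m))
  end.

Definition smooth_circle (f : R -> R) : Prop :=
  (forall x : R, f (x + 1) = f x) /\
  (forall (n : nat) (x : R), ex_derive_n f n x).

Definition CM_norm (M : nat) (f : R -> R) : Rbar :=
  Rbar_sum (fun k => sup_norm (fun _ : R => True) (Derive_n f k)) M.

Definition strictly_convex (lambda : R) (f : R -> R) : Prop :=
  forall x : R, lambda <= Derive_n f 2 x + 1.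

Definition open_strip (p : R * R) : Prop := 0 < snd p < 1.
Definition closed_strip (p : R * R) : Prop := 0 <= snd p <= 1.

(* The sum over a + b <= N of the sup norms over X x (0,1) of the derivatives
   d_x^a d_t^b u. *)
Definition CN_norm (N : nat) (u : R -> R -> R) : Rbar :=
  Rbar_sum (fun a =>
    Rbar_sum (fun b =>
      sup_norm open_strip (fun p => partial_derive a b u (fst p) (snd p)))
    (N - a)) N.

(* Positive semidefiniteness of the symmetric matrix with rows (a, b), (b, d). *)
Definition psd2 (a b d : R) : Prop :=
  forall v w : R, 0 <= a * v ^ 2 + 2 * b * v * w + d * w ^ 2.

(* Classical solutions: smooth on X x (0,1), continuous on X x [0,1].  No
   smoothness up to the boundary is assumed. *)
Record is_solution (eps : R) (u0 u1 : R -> R) (u : R -> R -> R) : Prop := {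
  sol_periodic : forall x t : R, 0 <= t <= 1 -> u (x + 1) t = u x t;
  sol_smooth : forall (n : nat) (x t : R), 0 < t < 1 -> ex_diff_n u n x t;
  sol_continuous :
    continuous_on closed_strip (fun p : R * R => u (fst p) (snd p));
  sol_equation : forall x t : R, 0 < t < 1 ->
    partial_derive 0 2 u x t * (1 + partial_derive 2 0 u x t)
      - (partial_derive 1 1 u x t) ^ 2 = eps;
  sol_psd : forall x t : R, 0 < t < 1 ->
    psd2 (partial_derive 2 0 u x t + 1)
         (partial_derive 1 1 u x t)
         (partial_derive 0 2 u x t);
  sol_bottom : forall x : R, u x 0 = u0 x;
  sol_top : forall x : R, u x 1 = u1 x
}.

(* Main.v *)
Require Import Defs.
From Stdlib Require Import Reals ZArith Lra Lia ClassicalEpsilon FunctionalExtensionality.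
From Coquelicot Require Import Coquelicot.
Open Scope R_scope.

(* The partial Legendre transform linearises the equation.  Let [psi(y,t)] be the Legendre
   transform of [u + x^2/2] in [x].  At [y = x + u_x] one has [psi_y = x], [psi_t = - u_t],
   [psi_yy = 1 / (1 + u_xx)] and [psi_tt = - (u_tt - u_xt^2 / (1 + u_xx)) = - eps psi_yy].
   Hence [w = psi - y^2/2 + eps t^2/2] is 1-periodic in [y] and satisfies
   [w_tt + eps w_yy = 0].  The maximum principle bounds every [d_y^k w] by its boundary values,
   which are controlled by the Dirichlet data; in particular [1 + u_xx] stays bounded.
   The equation and [eps <= eps0] then bound [d_y^k w_tt], hence [d_y^k w_t] by interpolation on
   [0 < t < 1].  Every derivative of [u] except [u] and [u_x] is a universal polynomial in
   [eps], [1 + u_xx], the [d_y^k psi] with [k >= 2] and the [d_y^k psi_t]. *)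

(** * The maximum principle on the strip *)

(** As [eps] tends to 0 the linear equation loses its ellipticity in [y] and elliptic regularity
    estimates degenerate. The maximum principle does not; it is applied only to [w] and its
    [y]-derivatives, whose boundary values are explicit. Nothing is known about [u_t] at t = 0 and t
    = 1, so time derivatives are estimated from the interior alone. An upper bound on [eps] has to
    enter the constants: for zero data, u = eps (t^2 - t) / 2 is a solution. At the boundary,
    [lambda] bounds the negative powers of 1 + u_xx that occur in d_y^k psi. Inside, strict
    convexity is at first only qualitative, from eps > 0 and semidefiniteness; the maximum principle
    makes it quantitative. Since d_t^2 psi = - eps d_y^2 psi, further time derivatives bring in only
    nonnegative powers of [eps]. *)

Lemma le_of_forall_lt_plus (a b : R) : (forall e, 0 < e -> a <= b + e) -> a <= b.
Proof.
  intros H. destruct (Rle_dec a b) as [|n]; [assumption|].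
  specialize (H ((a - b) / 2)). lra.
Qed.

Lemma mean_value (f f' : R -> R) (a b : R) :
  a < b -> (forall x, a <= x <= b -> is_derive f x (f' x)) ->
  exists c, a < c < b /\ f b - f a = f' c * (b - a).
Proof.
  intros Hab Hd. destruct (MVT_cor2 f f' a b Hab) as [c [Hc1 Hc2]].
  - intros x Hx. apply is_derive_Reals, Hd, Hx.
  - now exists c.
Qed.

(** [f1] vanishes at [c] by Fermat; if [l] were positive, [f1] would be positive just to the right
    of [c] and [f] would exceed its maximum there. *)
Lemma second_derivative_at_max (f f1 : R -> R) (l c r : R) :
  0 < r -> (forall x, Rabs (x - c) < r -> is_derive f x (f1 x)) ->
  is_derive f1 c l -> (forall x, Rabs (x - c) < r -> f x <= f c) -> l <= 0.
Proof.
  intros Hr Hf Hf1 Hmax. destruct (Rle_dec l 0) as [|Hl]; [assumption|exfalso].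
  assert (Hc : f1 c = 0).
  { assert (Hd : derivable_pt_lim f c (f1 c)).
    { apply is_derive_Reals, Hf. rewrite Rminus_diag, Rabs_R0. exact Hr. }
    rewrite <- (derive_pt_eq_0 f c (f1 c) (exist _ (f1 c) Hd) Hd).
    apply (deriv_maximum f (c - r) (c + r)); try lra.
    intros x H1 H2. apply Hmax, Rabs_def1; lra. }
  assert (Hl' : 0 < l) by lra.
  apply is_derive_Reals in Hf1. destruct (Hf1 l Hl') as [d Hd].
  pose proof (cond_pos d) as Hdp.
  set (h := Rmin d r / 2).
  assert (Hh : 0 < h < d /\ h < r).
  { unfold h. pose proof (Rmin_l d r). pose proof (Rmin_r d r).
    assert (0 < Rmin d r) by (apply Rmin_pos; assumption). lra. }
  destruct (mean_value f f1 c (c + h)) as [x [Hx Ex]]; [lra| |].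
  { intros x Hx. apply Hf, Rabs_def1; lra. }
  assert (Hf1x : 0 < f1 x).
  { specialize (Hd (x - c)). rewrite Hc in Hd. replace (c + (x - c)) with x in Hd by ring.
    rewrite Rminus_0_r in Hd.
    assert (H : Rabs (f1 x / (x - c) - l) < l).
    { apply Hd; [lra|]. apply Rabs_def1; lra. }
    apply Rabs_def2 in H. replace (f1 x) with (f1 x / (x - c) * (x - c)) by (field; lra).
    apply Rmult_lt_0_compat; lra. }
  assert (f (c + h) <= f c) by (apply Hmax, Rabs_def1; lra).
  assert (0 < f1 x * (c + h - c)) by (apply Rmult_lt_0_compat; lra).
  lra.
Qed.

Lemma periodic_shift (f : R -> R) :
  (forall x, f (x + 1) = f x) -> forall n x, f (x + IZR n) = f x.
Proof.
  intros Hf.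
  assert (Hn : forall (n : nat) x, f (x + INR n) = f x).
  { induction n as [|n IH]; intros x; [now rewrite Rplus_0_r|].
    rewrite S_INR, <- Rplus_assoc, Hf. apply IH. }
  intros n x. destruct n as [|p|p].
  - now rewrite Rplus_0_r.
  - rewrite <- positive_nat_Z, <- INR_IZR_INZ. apply Hn.
  - change (Z.neg p) with (- Z.pos p)%Z.
    rewrite opp_IZR, <- positive_nat_Z, <- INR_IZR_INZ.
    rewrite <- (Hn (Pos.to_nat p) (x + _)). f_equal; ring.
Qed.

Lemma unit_interval_representative (x : R) : exists z n, 0 <= z <= 1 /\ x = z + IZR n.
Proof.
  exists (frac_part x), (Int_part x). destruct (base_fp x).
  split; [lra|]. unfold frac_part. ring.
Qed.

(** The maximum is taken in [y] and then in [x]. The chosen maximiser [m x] need not be continuous,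
    but [F x (m x)] is, because uniform continuity moves all the values [F x y], hence their
    maximum, by less than [e]. *)
Lemma continuous_max_on_square (F : R -> R -> R) :
  (forall x y, continuity_2d_pt F x y) ->
  exists x0 y0, 0 <= x0 <= 1 /\ 0 <= y0 <= 1 /\
    forall x y, 0 <= x <= 1 -> 0 <= y <= 1 -> F x y <= F x0 y0.
Proof.
  intros HF.
  assert (Hy : forall x, exists y, (forall c, 0 <= c <= 1 -> F x c <= F x y) /\ 0 <= y <= 1).
  { intros x. apply continuity_ab_maj; [lra|]. intros c _.
    apply continuity_pt_locally. intros e.
    destruct (HF x c e) as [d Hd]. exists d. intros v Hv.
    apply Hd; [|exact Hv]. rewrite Rminus_diag, Rabs_R0. apply cond_pos. }
  apply choice in Hy. destruct Hy as [m Hm].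
  destruct (continuity_ab_maj (fun x => F x (m x)) 0 1) as [x0 [Hx0 Ix0]]; [lra| |].
  - intros c _. apply continuity_pt_locally. intros e.
    destruct (uniform_continuity_2d F (c - 1) (c + 1) 0 1 (fun x y _ _ => HF x y) e) as [d Hd].
    exists (mkposreal (Rmin d 1) (Rmin_pos _ _ (cond_pos d) Rlt_0_1)). intros v Hv.
    assert (H1 : Rabs (v - c) < d /\ Rabs (v - c) < 1).
    { unfold ball in Hv; simpl in Hv; unfold AbsRing_ball, abs, minus, plus, opp in Hv;
        simpl in Hv.
      pose proof (Rmin_l d 1). pose proof (Rmin_r d 1).
      unfold Rminus; split; eapply Rlt_le_trans; eauto. }
    destruct H1 as [H1 H2]. apply Rabs_def2 in H2.
    destruct (Hm v) as [Mv Iv]. destruct (Hm c) as [Mc Ic].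
    assert (A : forall y, 0 <= y <= 1 -> Rabs (F v y - F c y) < e).
    { intros y Iy. apply Hd; try lra.
      - rewrite Rminus_diag, Rabs_R0. apply cond_pos. }
    pose proof (A _ Iv) as A1. pose proof (A _ Ic) as A2.
    apply Rabs_def2 in A1. apply Rabs_def2 in A2.
    specialize (Mv _ Ic). specialize (Mc _ Iv). apply Rabs_def1; lra.
  - exists x0, (m x0). destruct (Hm x0) as [_ I0]. repeat split; try apply Ix0; try apply I0.
    intros x y Ix Iy. apply Rle_trans with (F x (m x)); [now apply Hm|now apply Hx0].
Qed.

(** Retraction onto [0,1]: composing with it replaces the junk values at other times and keeps
    moduli of continuity. *)
Definition clamp (t : R) : R := Rmax 0 (Rmin 1 t).

Lemma clamp_range (t : R) : 0 <= clamp t <= 1.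
Proof.
  unfold clamp. split; [apply Rmax_l|].
  apply Rmax_lub; [lra|apply Rmin_l].
Qed.

Lemma clamp_id (t : R) : 0 <= t <= 1 -> clamp t = t.
Proof. intros H. unfold clamp. rewrite Rmin_right, Rmax_right; lra. Qed.

Lemma clamp_lipschitz (s t : R) : Rabs (clamp s - clamp t) <= Rabs (s - t).
Proof.
  unfold clamp, Rmax, Rmin.
  repeat destruct Rle_dec; unfold Rabs; repeat destruct Rcase_abs; lra.
Qed.

Definition strip_uniformly_continuous (w : R -> R -> R) : Prop :=
  forall e, 0 < e -> exists d, 0 < d /\ forall y z s t,
    0 <= s <= 1 -> 0 <= t <= 1 -> Rabs (y - z) < d -> Rabs (s - t) < d ->
    Rabs (w y s - w z t) < e.

(** Derivatives are taken in each variable separately and only inside, and continuity up to the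
    boundary is asked of [w] alone; this form is inherited by difference quotients in [y]. *)
Record strip_harmonic (eps : R) (w wy wyy wt wtt : R -> R -> R) : Prop := {
  sh_periodic : forall y t, 0 <= t <= 1 -> w (y + 1) t = w y t;
  sh_continuous : strip_uniformly_continuous w;
  sh_dy : forall y t, 0 < t < 1 -> is_derive (fun z => w z t) y (wy y t);
  sh_dyy : forall y t, 0 < t < 1 -> is_derive (fun z => wy z t) y (wyy y t);
  sh_dt : forall y t, 0 < t < 1 -> is_derive (w y) t (wt y t);
  sh_dtt : forall y t, 0 < t < 1 -> is_derive (wt y) t (wtt y t);
  sh_equation : forall y t, 0 < t < 1 -> wtt y t + eps * wyy y t = 0
}.

(** At an interior maximum w_tt <= 0 and w_yy <= 0 do not contradict the equation. Adding d t^2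
    forces w_tt <= - 2 d, which does. *)
Lemma strip_maximum_principle (eps : R) (w wy wyy wt wtt : R -> R -> R) (m : R) :
  0 < eps -> strip_harmonic eps w wy wyy wt wtt ->
  (forall y, w y 0 <= m) -> (forall y, w y 1 <= m) ->
  forall y t, 0 <= t <= 1 -> w y t <= m.
Proof.
  intros He H H0 H1 y t It.
  destruct (Rle_dec (w y t) m) as [|Hn]; [assumption|exfalso].
  (* Half of the excess: the perturbation is at most [d], so boundary values stay below m + 2 d = w
     y t and the maximum is interior. *)
  set (d := (w y t - m) / 2).
  assert (Hd : 0 < d) by (unfold d; lra).
  destruct (continuous_max_on_square (fun y t => w y (clamp t) + d * (clamp t * clamp t)))
    as [y0 [t0 [Iy0 [It0 Hmax]]]].
  { intros a b. apply continuity_2d_pt_plus.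
    - intros e. destruct (sh_continuous _ _ _ _ _ _ H e (cond_pos e)) as [r [Hr Hw]].
      exists (mkposreal r Hr). intros u v Hu Hv. apply Hw; try apply clamp_range; [exact Hu|].
      eapply Rle_lt_trans; [apply clamp_lipschitz|exact Hv].
    - assert (Hc : continuity_2d_pt (fun _ v => clamp v) a b).
      { intros e. exists e. intros u v Hu Hv. eapply Rle_lt_trans; [apply clamp_lipschitz|exact Hv]. }
      apply continuity_2d_pt_mult; [apply continuity_2d_pt_const|].
      now apply continuity_2d_pt_mult. }
  assert (Hper : forall s, 0 <= s <= 1 -> forall a n, w (a + IZR n) s = w a s).
  { intros s Is a n. apply (periodic_shift (fun a => w a s)).
    intros x. now apply (sh_periodic _ _ _ _ _ _ H). }
  assert (Hmax' : forall a s, 0 <= s <= 1 -> w a s + d * (s * s) <= w y0 t0 + d * (t0 * t0)).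
  { intros a s Is. destruct (unit_interval_representative a) as [z [n [Iz ->]]].
    rewrite Hper by assumption. specialize (Hmax z s Iz Is).
    rewrite !clamp_id in Hmax by assumption. exact Hmax. }
  assert (Hyt : 0 <= d * (t * t)) by (apply Rmult_le_pos; [lra|apply Rle_0_sqr]).
  pose proof (Hmax' y t It) as Hbig.
  assert (It0' : 0 < t0 < 1).
  { destruct (Req_dec t0 0) as [E|]; [|destruct (Req_dec t0 1) as [E|]; [|lra]];
      exfalso; rewrite E in Hbig.
    - specialize (H0 y0). lra.
    - specialize (H1 y0). unfold d in Hbig at 2. lra. }
  assert (Hyy : wyy y0 t0 <= 0).
  { apply (second_derivative_at_max (fun z => w z t0) (fun z => wy z t0) _ y0 1); [lra| | |].
    - intros x _. now apply (sh_dy _ _ _ _ _ _ H).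
    - now apply (sh_dyy _ _ _ _ _ _ H).
    - intros x _. specialize (Hmax' x t0 It0). lra. }
  assert (Htt : wtt y0 t0 + 2 * d <= 0).
  { apply (second_derivative_at_max (fun s => w y0 s + d * (s * s))
             (fun s => wt y0 s + 2 * d * s) _ t0 (Rmin t0 (1 - t0))).
    - apply Rmin_pos; lra.
    - intros x Hx. apply Rabs_def2 in Hx.
      pose proof (Rmin_l t0 (1 - t0)). pose proof (Rmin_r t0 (1 - t0)).
      apply @is_derive_plus; [apply (sh_dt _ _ _ _ _ _ H); lra|].
      auto_derive; [trivial|ring].
    - apply @is_derive_plus; [now apply (sh_dtt _ _ _ _ _ _ H)|].
      auto_derive; [trivial|ring].
    - intros x Hx. apply Rabs_def2 in Hx.
      pose proof (Rmin_l t0 (1 - t0)). pose proof (Rmin_r t0 (1 - t0)).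
      apply Hmax'. lra. }
  pose proof (sh_equation _ _ _ _ _ _ H y0 t0 It0') as Heq.
  assert (0 <= eps * - wyy y0 t0) by (apply Rmult_le_pos; lra).
  lra.
Qed.

(** * Difference quotients and derivative bounds on the strip *)

Definition dq (h : R) (w : R -> R -> R) (y t : R) : R := (w (y + h) t - w y t) / h.

Lemma is_derive_shift (f : R -> R) (h x l : R) :
  is_derive f (x + h) l -> is_derive (fun z => f (z + h)) x l.
Proof.
  intros Hf. evar_last.
  - apply (is_derive_comp f (fun z => z + h)); [exact Hf|].
    apply @is_derive_plus; [apply @is_derive_id|apply @is_derive_const].
  - unfold scal, plus, zero, one; simpl; unfold mult; simpl. ring.
Qed.

Lemma is_derive_difference_quotient (f g : R -> R) (h x lf lg : R) :
  is_derive f x lf -> is_derive g x lg ->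
  is_derive (fun z => (f z - g z) / h) x ((lf - lg) / h).
Proof.
  intros Hf Hg. unfold Rdiv.
  apply (is_derive_ext (fun z => / h * (f z - g z))); [intros; apply Rmult_comm|].
  rewrite Rmult_comm. apply is_derive_scal. now apply @is_derive_minus.
Qed.

Lemma strip_harmonic_dq (eps : R) (w wy wyy wt wtt : R -> R -> R) (h : R) :
  0 < h -> strip_harmonic eps w wy wyy wt wtt ->
  strip_harmonic eps (dq h w) (dq h wy) (dq h wyy) (dq h wt) (dq h wtt).
Proof.
  intros Hh [Hp Hc H1 H2 H3 H4 He]. constructor; unfold dq.
  - intros y t It. replace (y + 1 + h) with (y + h + 1) by ring. now rewrite !Hp.
  - intros e Hep. destruct (Hc (e * h / 2)) as [d [Hd Hw]].
    { apply Rmult_lt_0_compat; [|lra]. now apply Rmult_lt_0_compat. }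
    exists d. split; [exact Hd|]. intros y z s t Is It Hyz Hst.
    assert (A1 := Hw y z s t Is It Hyz Hst).
    assert (A2 : Rabs (w (y + h) s - w (z + h) t) < e * h / 2).
    { apply Hw; try assumption. now replace (y + h - (z + h)) with (y - z) by ring. }
    replace ((w (y + h) s - w y s) / h - (w (z + h) t - w z t) / h)
      with ((w (y + h) s - w (z + h) t - (w y s - w z t)) / h) by (field; lra).
    apply Rabs_def2 in A1. apply Rabs_def2 in A2.
    unfold Rdiv. rewrite Rabs_mult, (Rabs_pos_eq (/ h)) by (left; now apply Rinv_0_lt_compat).
    apply Rmult_lt_reg_r with h; [assumption|].
    rewrite Rmult_assoc, Rinv_l, Rmult_1_r by lra. apply Rabs_def1; lra.
  - intros y t It. apply is_derive_difference_quotient; [|now apply H1].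
    apply (is_derive_shift (fun z => w z t)). now apply H1.
  - intros y t It. apply is_derive_difference_quotient; [|now apply H2].
    apply (is_derive_shift (fun z => wy z t)). now apply H2.
  - intros y t It. apply is_derive_difference_quotient; now apply H3.
  - intros y t It. apply is_derive_difference_quotient; now apply H4.
  - intros y t It. pose proof (He y t It). pose proof (He (y + h) t It).
    replace (wtt (y + h) t) with (- (eps * wyy (y + h) t)) by lra.
    replace (wtt y t) with (- (eps * wyy y t)) by lra. field. lra.
Qed.

Lemma strip_harmonic_iter_dq (eps : R) (w wy wyy wt wtt : R -> R -> R) (h : R) (k : nat) :
  0 < h -> strip_harmonic eps w wy wyy wt wtt ->
  strip_harmonic eps (Nat.iter k (dq h) w) (Nat.iter k (dq h) wy) (Nat.iter k (dq h) wyy)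
    (Nat.iter k (dq h) wt) (Nat.iter k (dq h) wtt).
Proof.
  intros Hh H. induction k as [|k IH]; [exact H|]. simpl. now apply strip_harmonic_dq.
Qed.

(** One mean value per quotient, applied to the family [dq h (g i)], which has the same chain of
    derivatives. Bounds on [g k] thus pass to the quotients with the same constant, and letting [h]
    tend to 0 brings them back. *)
Lemma iter_dq_mean_value (h t : R) (k : nat) (g : nat -> R -> R -> R) (y : R) :
  0 < h -> (forall i z, is_derive (fun x => g i x t) z (g (S i) z t)) ->
  exists x, y <= x <= y + INR k * h /\ Nat.iter k (dq h) (g O) y t = g k x t.
Proof.
  intros Hh. revert g y. induction k as [|k IH]; intros g y Hg.
  - exists y. simpl. split; [lra|reflexivity].
  - destruct (IH (fun i => dq h (g i)) y) as [z [Iz Ez]].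
    { intros i z. unfold dq. apply is_derive_difference_quotient; [|apply Hg].
      apply (is_derive_shift (fun x => g i x t)). apply Hg. }
    destruct (mean_value (fun x => g k x t) (fun x => g (S k) x t) z (z + h)) as [x [Ix Ex]].
    { lra. } { intros x _. apply Hg. }
    exists x. rewrite S_INR. split; [lra|].
    rewrite Nat.iter_succ_r, Ez. unfold dq. rewrite Ex. field. lra.
Qed.

Lemma le_of_nearby_le (f : R -> R) (l x m : R) :
  is_derive f x l -> (forall d, 0 < d -> exists z, x <= z <= x + d /\ f z <= m) -> f x <= m.
Proof.
  intros Hf H. apply le_of_forall_lt_plus. intros e He.
  assert (Hc : continuity_pt f x).
  { apply continuity_pt_filterlim. apply (ex_derive_continuous f). now exists l. }
  rewrite continuity_pt_locally in Hc. destruct (Hc (mkposreal e He)) as [d Hd].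
  pose proof (cond_pos d).
  destruct (H (d / 2)) as [z [Iz Hz]]; [lra|].
  assert (A : Rabs (f z - f x) < e).
  { apply Hd. change (Rabs (z - x) < d). apply Rabs_def1; lra. }
  apply Rabs_def2 in A. lra.
Qed.

Lemma iter_dq_limit_le (t m : R) (k : nat) (g : nat -> R -> R -> R) (y : R) :
  (forall i z, is_derive (fun x => g i x t) z (g (S i) z t)) ->
  (forall h, 0 < h -> Nat.iter k (dq h) (g O) y t <= m) -> g k y t <= m.
Proof.
  intros Hg H. apply (le_of_nearby_le (fun x => g k x t) (g (S k) y t)); [apply Hg|].
  intros d Hd. pose proof (pos_INR k).
  (* This step keeps the mean value point within k h <= d of [y]; the + 1 covers k = 0. *)
  assert (Hh : 0 < d / (INR k + 1)) by (apply Rdiv_lt_0_compat; lra).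
  destruct (iter_dq_mean_value (d / (INR k + 1)) t k g y Hh Hg) as [z [Iz Ez]].
  exists z. split.
  - assert (INR k * (d / (INR k + 1)) <= d).
    { replace d with ((INR k + 1) * (d / (INR k + 1))) at 2 by (field; lra).
      apply Rmult_le_compat_r; lra. }
    lra.
  - rewrite <- Ez. now apply H.
Qed.

(* Only [w] itself is continuous up to the boundary, so the maximum principle is applied to
   its difference quotients rather than to its derivatives. *)
Lemma harmonic_dy_le (eps m : R) (wy wyy wt wtt : R -> R -> R) (g : nat -> R -> R -> R) (k : nat) :
  0 < eps -> strip_harmonic eps (g O) wy wyy wt wtt ->
  (forall i y t, 0 <= t <= 1 -> is_derive (fun z => g i z t) y (g (S i) y t)) ->
  (forall y, g k y 0 <= m) -> (forall y, g k y 1 <= m) ->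
  forall y t, 0 <= t <= 1 -> g k y t <= m.
Proof.
  intros He H Hg H0 H1 y t It. apply iter_dq_limit_le; [intros; now apply Hg|]. intros h Hh.
  apply (strip_maximum_principle eps _ _ _ _ _ m He (strip_harmonic_iter_dq _ _ _ _ _ _ h k Hh H));
    [| |exact It]; intros z.
  - destruct (iter_dq_mean_value h 0 k g z Hh) as [x [_ ->]]; [|apply H0].
    intros. apply Hg. lra.
  - destruct (iter_dq_mean_value h 1 k g z Hh) as [x [_ ->]]; [|apply H1].
    intros. apply Hg. lra.
Qed.

Lemma strip_harmonic_opp (eps : R) (w wy wyy wt wtt : R -> R -> R) :
  strip_harmonic eps w wy wyy wt wtt ->
  strip_harmonic eps (fun y t => - w y t) (fun y t => - wy y t) (fun y t => - wyy y t)
    (fun y t => - wt y t) (fun y t => - wtt y t).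
Proof.
  intros [Hp Hc H1 H2 H3 H4 He]. constructor.
  - intros y t It. now rewrite Hp.
  - intros e Hep. destruct (Hc e Hep) as [d [Hd Hw]]. exists d. split; [exact Hd|].
    intros y z s t Is It Hyz Hst. replace (- w y s - - w z t) with (- (w y s - w z t)) by ring.
    rewrite Rabs_Ropp. now apply Hw.
  - intros y t It. apply @is_derive_opp. now apply H1.
  - intros y t It. apply @is_derive_opp. now apply H2.
  - intros y t It. apply @is_derive_opp. now apply H3.
  - intros y t It. apply @is_derive_opp. now apply H4.
  - intros y t It. specialize (He y t It). lra.
Qed.

Lemma harmonic_dy_ge (eps m : R) (wy wyy wt wtt : R -> R -> R) (g : nat -> R -> R -> R) (k : nat) :
  0 < eps -> strip_harmonic eps (g O) wy wyy wt wtt ->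
  (forall i y t, 0 <= t <= 1 -> is_derive (fun z => g i z t) y (g (S i) y t)) ->
  (forall y, m <= g k y 0) -> (forall y, m <= g k y 1) ->
  forall y t, 0 <= t <= 1 -> m <= g k y t.
Proof.
  intros He H Hg H0 H1 y t It. apply Ropp_le_cancel.
  apply (harmonic_dy_le eps (- m) _ _ _ _ (fun i y t => - g i y t) k He (strip_harmonic_opp _ _ _ _ _ _ H));
    [| | |exact It].
  - intros i z s Is. apply @is_derive_opp. now apply Hg.
  - intros z. apply Ropp_le_contravar, H0.
  - intros z. apply Ropp_le_contravar, H1.
Qed.

Lemma harmonic_dy_bound (eps B : R) (wy wyy wt wtt : R -> R -> R) (g : nat -> R -> R -> R) (k : nat) :
  0 < eps -> strip_harmonic eps (g O) wy wyy wt wtt ->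
  (forall i y t, 0 <= t <= 1 -> is_derive (fun z => g i z t) y (g (S i) y t)) ->
  (forall y, Rabs (g k y 0) <= B) -> (forall y, Rabs (g k y 1) <= B) ->
  forall y t, 0 <= t <= 1 -> Rabs (g k y t) <= B.
Proof.
  intros He H Hg H0 H1 y t It.
  assert (H0' : forall z, - B <= g k z 0 <= B) by (intros z; now apply Rabs_le_between).
  assert (H1' : forall z, - B <= g k z 1 <= B) by (intros z; now apply Rabs_le_between).
  apply Rabs_le. split.
  - apply (harmonic_dy_ge eps _ _ _ _ _ _ _ He H Hg);
      [intros z; apply H0'|intros z; apply H1'|exact It].
  - apply (harmonic_dy_le eps _ _ _ _ _ _ _ He H Hg);
      [intros z; apply H0'|intros z; apply H1'|exact It].
Qed.

(** The mean value theorem on an interval of length 1/4 gives a point where |f1| <= 2 B0 / (1/4) = 8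
    B0; from there to [t], [f1] changes by at most [B2]. *)
Lemma interpolation_bound (f f1 f2 : R -> R) (B0 B2 t : R) :
  (forall s, 0 < s < 1 -> is_derive f s (f1 s)) ->
  (forall s, 0 < s < 1 -> is_derive f1 s (f2 s)) ->
  (forall s, 0 < s < 1 -> Rabs (f s) <= B0) ->
  (forall s, 0 < s < 1 -> Rabs (f2 s) <= B2) ->
  0 < t < 1 -> Rabs (f1 t) <= 8 * B0 + B2.
Proof.
  intros H1 H2 HB0 HB2 It.
  assert (Hx : exists x, 0 < x < 1 /\ x <> t /\ Rabs (f1 x) <= 8 * B0).
  (* [t] is made an endpoint of the quarter interval, so the mean value point differs from [t]. *)
  { assert (Hs : exists s, 0 < s < 1 /\ 0 < s + 1 / 4 < 1 /\ (s = t \/ s + 1 / 4 = t)).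
    { destruct (Rlt_dec t (1 / 2)); [exists t|exists (t - 1 / 4)]; lra. }
    destruct Hs as [s [Is [Is' Hst]]].
    destruct (mean_value f f1 s (s + 1 / 4)) as [x [Ix Ex]]; [lra| |].
    { intros x Hx. apply H1. lra. }
    exists x. repeat split; try lra.
    pose proof (HB0 _ Is) as A1. pose proof (HB0 _ Is') as A2.
    apply Rabs_le_between in A1. apply Rabs_le_between in A2.
    apply Rabs_le. lra. }
  destruct Hx as [x [Ix [Nx Bx]]].
  assert (Hd : Rabs (f1 t - f1 x) <= B2).
  { assert (D : forall a b, 0 < a < 1 -> 0 < b < 1 -> a < b -> Rabs (f1 b - f1 a) <= B2).
    { intros a b Ia Ib Hab. destruct (mean_value f1 f2 a b Hab) as [c [Ic ->]].
      { intros; apply H2; lra. }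
      rewrite Rabs_mult, <- (Rmult_1_r B2). apply Rmult_le_compat; try apply Rabs_pos.
      - apply HB2. lra.
      - apply Rabs_le. lra. }
    destruct (Rtotal_order t x) as [L|[L|L]]; [|lra|]; [rewrite Rabs_minus_sym|]; apply D; lra. }
  replace (f1 t) with (f1 x + (f1 t - f1 x)) by ring.
  eapply Rle_trans; [apply Rabs_triang|lra].
Qed.

(** Only [r O] is known to be the time derivative of [g O]. Interpolating the difference quotients,
    and letting [h] tend to 0 afterwards, avoids exchanging d_t with d_y^k. *)
Lemma harmonic_dt_bound (eps B0 B2 : R) (wy wtt : R -> R -> R) (g r : nat -> R -> R -> R) (k : nat) :
  0 < eps -> strip_harmonic eps (g O) wy (g 2%nat) (r O) wtt ->
  (forall i y t, 0 < t < 1 -> is_derive (fun z => g i z t) y (g (S i) y t)) ->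
  (forall i y t, 0 < t < 1 -> is_derive (fun z => r i z t) y (r (S i) y t)) ->
  (forall y t, 0 < t < 1 -> Rabs (g k y t) <= B0) ->
  (forall y t, 0 < t < 1 -> Rabs (g (S (S k)) y t) <= B2) ->
  forall y t, 0 < t < 1 -> Rabs (r k y t) <= 8 * B0 + eps * B2.
Proof.
  intros He H Hg Hr HB0 HB2 y t It.
  assert (Hq : forall h, 0 < h -> Rabs (Nat.iter k (dq h) (r O) y t) <= 8 * B0 + eps * B2).
  { intros h Hh. pose proof (strip_harmonic_iter_dq _ _ _ _ _ _ h k Hh H) as Hk.
    apply (interpolation_bound (Nat.iter k (dq h) (g O) y) (Nat.iter k (dq h) (r O) y)
             (Nat.iter k (dq h) wtt y)); try assumption.
    - intros s Is. now apply (sh_dt _ _ _ _ _ _ Hk).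
    - intros s Is. now apply (sh_dtt _ _ _ _ _ _ Hk).
    - intros s Is. destruct (iter_dq_mean_value h s k g y Hh) as [x [_ ->]]; [|now apply HB0].
      intros. now apply Hg.
    - intros s Is. pose proof (sh_equation _ _ _ _ _ _ Hk y s Is) as E.
      destruct (iter_dq_mean_value h s k (fun i => g (S (S i))) y Hh) as [x [_ Ex]].
      { intros. now apply Hg. }
      cbv beta in Ex. rewrite Ex in E.
      replace (Nat.iter k (dq h) wtt y s) with (- (eps * g (S (S k)) x s)) by lra.
      rewrite Rabs_Ropp, Rabs_mult, (Rabs_pos_eq eps) by lra.
      apply Rmult_le_compat_l; [lra|now apply HB2]. }
  apply Rabs_le. split.
  (* [iter_dq_limit_le] passes only upper bounds to the limit, so the lower bound is proved for
     [- r]. *)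
  - apply Ropp_le_cancel. rewrite Ropp_involutive.
    assert (Hopp : forall h n (f : R -> R -> R) y t,
      Nat.iter n (dq h) (fun y t => - f y t) y t = - Nat.iter n (dq h) f y t).
    { clear. intros h n f. induction n as [|n IH]; intros y t; simpl; [reflexivity|].
      unfold dq at 1 3. rewrite !IH. unfold Rdiv. ring. }
    apply (iter_dq_limit_le t _ k (fun i y t => - r i y t)).
    + intros. apply @is_derive_opp. now apply Hr.
    + intros h Hh. rewrite Hopp. specialize (Hq h Hh). apply Rabs_le_between in Hq. lra.
  - apply iter_dq_limit_le; [intros; now apply Hr|].
    intros h Hh. specialize (Hq h Hh). apply Rabs_le_between in Hq. lra.
Qed.

(** * Formal polynomials and implicit functions *)

(* Formal polynomials with a formal derivation: the same expression serves for all solutions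
   at once, which is what makes its bound uniform. *)
Inductive poly (A : Type) : Type :=
| PAtom (a : A)
| PConst (c : R)
| PAdd (p q : poly A)
| PMul (p q : poly A)
| POpp (p : poly A).

Arguments PAtom {A} a.
Arguments PConst {A} c.
Arguments PAdd {A} p q.
Arguments PMul {A} p q.
Arguments POpp {A} p.

Fixpoint eval {A : Type} (rho : A -> R) (p : poly A) : R :=
  match p with
  | PAtom a => rho a
  | PConst c => c
  | PAdd p q => eval rho p + eval rho q
  | PMul p q => eval rho p * eval rho q
  | POpp p => - eval rho p
  end.

Fixpoint deriv {A : Type} (d : A -> poly A) (p : poly A) : poly A :=
  match p with
  | PAtom a => d a
  | PConst c => PConst 0
  | PAdd p q => PAdd (deriv d p) (deriv d q)
  | PMul p q => PAdd (PMul (deriv d p) q) (PMul p (deriv d q))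
  | POpp p => POpp (deriv d p)
  end.

Lemma is_derive_eval {A : Type} (rho : R -> A -> R) (d : A -> poly A) (x : R) (p : poly A) :
  (forall a, is_derive (fun z => rho z a) x (eval (rho x) (d a))) ->
  is_derive (fun z => eval (rho z) p) x (eval (rho x) (deriv d p)).
Proof.
  intros H. induction p as [a|c|p IHp q IHq|p IHp q IHq|p IHp]; simpl.
  - apply H.
  - apply @is_derive_const.
  - now apply @is_derive_plus.
  - now apply Derive.is_derive_mult.
  - now apply @is_derive_opp.
Qed.

(** The commutator of two derivations is a derivation, so it vanishes once it does on atoms. *)
Lemma eval_deriv_comm {A : Type} (rho : A -> R) (d1 d2 : A -> poly A) (p : poly A) :
  (forall a, eval rho (deriv d1 (d2 a)) = eval rho (deriv d2 (d1 a))) ->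
  eval rho (deriv d1 (deriv d2 p)) = eval rho (deriv d2 (deriv d1 p)).
Proof.
  intros H. induction p as [a|c|p IHp q IHq|p IHp q IHq|p IHp]; simpl.
  - apply H.
  - reflexivity.
  - now rewrite IHp, IHq.
  - rewrite IHp, IHq. ring.
  - now rewrite IHp.
Qed.

(** The quantifiers follow those of the theorem: [M] is fixed before the parameters [th], and [C]
    before the solution. Monotonicity of [Good] lets the larger [M] serve both operands. *)
Lemma poly_bound {A T : Type} (Good : nat -> T -> (A -> R) -> Prop) :
  (forall M M' th rho, (M <= M')%nat -> Good M' th rho -> Good M th rho) ->
  (forall a, exists M, forall th, exists C, forall rho, Good M th rho -> Rabs (rho a) <= C) ->
  forall p : poly A,
    exists M, forall th, exists C, forall rho, Good M th rho -> Rabs (eval rho p) <= C.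
Proof.
  intros Hmon Hat p. induction p as [a|c|p [M1 H1] q [M2 H2]|p [M1 H1] q [M2 H2]|p [M1 H1]]; simpl.
  - apply Hat.
  - exists O. intros th. exists (Rabs c). intros. apply Rle_refl.
  - exists (max M1 M2). intros th. destruct (H1 th) as [C1 HC1]. destruct (H2 th) as [C2 HC2].
    exists (C1 + C2). intros rho G. eapply Rle_trans; [apply Rabs_triang|].
    apply Rplus_le_compat; [apply HC1|apply HC2];
      (eapply Hmon; [|exact G]; lia).
  - exists (max M1 M2). intros th. destruct (H1 th) as [C1 HC1]. destruct (H2 th) as [C2 HC2].
    exists (C1 * C2). intros rho G. rewrite Rabs_mult.
    apply Rmult_le_compat; try apply Rabs_pos; [apply HC1|apply HC2];
      (eapply Hmon; [|exact G]; lia).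
  - exists M1. intros th. destruct (H1 th) as [C1 HC1]. exists C1. intros rho G.
    rewrite Rabs_Ropp. now apply HC1.
Qed.

Lemma strictly_increasing_of_derive (f f' : R -> R) :
  (forall x, is_derive f x (f' x)) -> (forall x, 0 < f' x) ->
  forall a b, a < b -> f a < f b.
Proof.
  intros Hf Hp a b Hab. destruct (mean_value f f' a b Hab) as [c [_ E]]; [intros; apply Hf|].
  assert (0 < f' c * (b - a)) by (apply Rmult_lt_0_compat; [apply Hp|lra]). lra.
Qed.

Lemma is_derive_continuity_pt (f : R -> R) (x l : R) : is_derive f x l -> continuity_pt f x.
Proof.
  intros H. apply continuity_pt_filterlim. apply (ex_derive_continuous f). now exists l.
Qed.

Lemma continuity_2d_pt_of_1d (f : R -> R) (x t : R) :
  continuity_pt f x -> continuity_2d_pt (fun z _ => f z) x t.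
Proof.
  intros H. apply (continuity_1d_2d_pt_comp f (fun z _ => z)); [exact H|].
  apply continuity_2d_pt_id1.
Qed.

Section ImplicitFunction.

Variables (F Fx Fs : R -> R -> R) (X : R -> R) (s0 r : R).
Hypothesis (Hr : 0 < r).
Hypothesis (HX : forall s, Rabs (s - s0) < r -> F (X s) s = 0).
Hypothesis (HFx : forall x s, Rabs (s - s0) < r -> is_derive (fun z => F z s) x (Fx x s)).
Hypothesis (HFs : forall x s, Rabs (s - s0) < r -> is_derive (F x) s (Fs x s)).
Hypothesis (Hpos : forall x s, Rabs (s - s0) < r -> 0 < Fx x s).

Let Fincr (s a b : R) : Rabs (s - s0) < r -> a < b -> F a s < F b s.
Proof.
  intros Hs. apply (strictly_increasing_of_derive (fun z => F z s) (fun z => Fx z s)); intros x.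
  - now apply HFx.
  - now apply Hpos.
Qed.

(** For [s] near [s0] the signs of [F] at X s0 - e and X s0 + e persist, and monotonicity in the
    first variable traps the root [X s] between them. *)
Lemma implicit_continuous (e : R) : 0 < e ->
  exists d, 0 < d <= r /\ forall s, Rabs (s - s0) < d -> Rabs (X s - X s0) < e.
Proof.
  intros He.
  assert (Hs0 : Rabs (s0 - s0) < r) by (now rewrite Rminus_diag, Rabs_R0).
  assert (Hup : 0 < F (X s0 + e) s0) by (rewrite <- (HX s0 Hs0); apply Fincr; [exact Hs0|lra]).
  assert (Hlo : F (X s0 - e) s0 < 0) by (rewrite <- (HX s0 Hs0); apply Fincr; [exact Hs0|lra]).
  pose proof (is_derive_continuity_pt _ _ _ (HFs (X s0 + e) s0 Hs0)) as Cu.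
  pose proof (is_derive_continuity_pt _ _ _ (HFs (X s0 - e) s0 Hs0)) as Cl.
  rewrite continuity_pt_locally in Cu, Cl.
  destruct (Cu (mkposreal _ Hup)) as [du Hdu].
  assert (Hlo' : 0 < - F (X s0 - e) s0) by lra.
  destruct (Cl (mkposreal _ Hlo')) as [dl Hdl].
  exists (Rmin r (Rmin du dl)).
  pose proof (Rmin_l r (Rmin du dl)). pose proof (Rmin_r r (Rmin du dl)).
  pose proof (Rmin_l du dl). pose proof (Rmin_r du dl).
  split.
  - split; [|assumption]. repeat apply Rmin_pos; [exact Hr|apply cond_pos|apply cond_pos].
  - intros s Hs. assert (Hsr : Rabs (s - s0) < r) by lra.
    assert (Au : Rabs (F (X s0 + e) s - F (X s0 + e) s0) < F (X s0 + e) s0).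
    { apply Hdu. change (Rabs (s - s0) < du). lra. }
    assert (Al : Rabs (F (X s0 - e) s - F (X s0 - e) s0) < - F (X s0 - e) s0).
    { apply Hdl. change (Rabs (s - s0) < dl). lra. }
    apply Rabs_def2 in Au. apply Rabs_def2 in Al.
    pose proof (HX s Hsr) as E.
    apply Rabs_def1.
    + destruct (Rlt_dec (X s) (X s0 + e)) as [|N]; [lra|exfalso].
      destruct (Req_dec (X s) (X s0 + e)) as [E'|N']; [rewrite E' in E; lra|].
      pose proof (Fincr s (X s0 + e) (X s) Hsr). lra.
    + destruct (Rlt_dec (X s0 - e) (X s)) as [|N]; [lra|exfalso].
      destruct (Req_dec (X s) (X s0 - e)) as [E'|N']; [rewrite E' in E; lra|].
      pose proof (Fincr s (X s) (X s0 - e) Hsr). lra.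
Qed.

(** The zero increment of [F] from (X s0, s0) to (X s, s) is split at (X s0, s). A mean value on
    each piece makes the difference quotient of [X] exactly [- Fs / Fx] at nearby points. *)
Lemma implicit_derive :
  continuity_2d_pt Fx (X s0) s0 -> continuity_2d_pt Fs (X s0) s0 ->
  is_derive X s0 (- Fs (X s0) s0 / Fx (X s0) s0).
Proof.
  intros Cx Cs. apply is_derive_Reals. intros e He.
  assert (Hs0 : Rabs (s0 - s0) < r) by (now rewrite Rminus_diag, Rabs_R0).
  set (a := Fs (X s0) s0) in *. set (b := Fx (X s0) s0) in *.
  assert (Hb : 0 < b) by (now apply Hpos).
  assert (Cq : continuity_2d_pt (fun u v => - u * / v) a b).
  { apply continuity_2d_pt_mult.
    - apply continuity_2d_pt_opp, continuity_2d_pt_id1.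
    - apply continuity_2d_pt_inv; [apply continuity_2d_pt_id2|lra]. }
  destruct (Cq (mkposreal e He)) as [q Hq].
  destruct (Cx q) as [dx Hdx]. destruct (Cs q) as [ds Hds].
  destruct (implicit_continuous dx (cond_pos dx)) as [d [[Hd Hdr] HdX]].
  assert (Hm : 0 < Rmin d (Rmin dx ds)) by (repeat apply Rmin_pos; try apply cond_pos; exact Hd).
  exists (mkposreal _ Hm). intros h Hh0 Hh. simpl in Hh.
  pose proof (Rmin_l d (Rmin dx ds)). pose proof (Rmin_r d (Rmin dx ds)).
  pose proof (Rmin_l dx ds). pose proof (Rmin_r dx ds).
  assert (Hs : Rabs (s0 + h - s0) < d) by (replace (s0 + h - s0) with h by ring; lra).
  set (s := s0 + h) in *.
  assert (Hsh : Rabs (s - s0) = Rabs h) by (unfold s; f_equal; ring).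
  assert (Hsr : Rabs (s - s0) < r) by lra.
  specialize (HdX s Hs).
  destruct (MVT_cor4 (fun z => F z s) (fun z => Fx z s) (X s0) (Rabs (X s - X s0))) with (b := X s)
    as [x [Ex Ix]].
  { intros c _. now apply HFx. } { apply Rle_refl. }
  destruct (MVT_cor4 (F (X s0)) (Fs (X s0)) s0 (Rabs (s - s0))) with (b := s)
    as [p [Ep Ip]].
  { intros c Hc. apply HFs. lra. } { apply Rle_refl. }
  rewrite (HX s Hsr) in Ex. rewrite (HX s0 Hs0) in Ep.
  assert (Hxp : 0 < Fx x s) by (now apply Hpos).
  replace ((X s - X s0) / h) with (- Fs (X s0) p * / Fx x s).
  - apply Hq.
    + apply Hds; [|lra]. rewrite Rminus_diag, Rabs_R0. apply cond_pos.
    + apply Hdx; lra.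
  - assert (Ehs : s - s0 = h) by (unfold s; ring). rewrite Ehs in Ep.
    replace (X s - X s0) with (- Fs (X s0) p * h / Fx x s); [field; lra|].
    apply (Rmult_eq_reg_r (Fx x s)); [|lra].
    unfold Rdiv. rewrite Rmult_assoc, Rinv_l by lra. lra.
Qed.

End ImplicitFunction.

(** * The partial Legendre transform *)

Lemma locally_2d_strip (x t : R) (P : R -> R -> Prop) :
  0 < t < 1 -> (forall u v, 0 < v < 1 -> P u v) -> locally_2d P x t.
Proof.
  intros It HP. assert (Hm : 0 < Rmin t (1 - t)) by (apply Rmin_pos; lra).
  exists (mkposreal _ Hm). intros u v _ Hv. simpl in Hv.
  pose proof (Rmin_l t (1 - t)). pose proof (Rmin_r t (1 - t)).
  apply Rabs_def2 in Hv. apply HP. lra.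
Qed.

(** [V a b] stands for d_x^a d_t^b u. The [x]-chain reaches t = 0 and t = 1, where the Legendre
    transform must be evaluated; the [t]-chain stays inside the strip. *)
Record solution_jet (eps : R) (V : nat -> nat -> R -> R -> R) : Prop := {
  sj_eps : 0 < eps;
  sj_dx : forall a b x t, 0 <= t <= 1 -> is_derive (fun z => V a b z t) x (V (S a) b x t);
  sj_dt : forall a b x t, 0 < t < 1 -> is_derive (V a b x) t (V a (S b) x t);
  sj_continuous : forall a b x t, 0 < t < 1 -> continuity_2d_pt (V a b) x t;
  sj_periodic : forall x t, 0 <= t <= 1 -> V O O (x + 1) t = V O O x t;
  sj_convex : forall x t, 0 <= t <= 1 -> 0 < 1 + V 2%nat O x t;
  sj_equation : forall x t, 0 < t < 1 ->
    V O 2%nat x t * (1 + V 2%nat O x t) - V 1%nat 1%nat x t ^ 2 = eps;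
  sj_uniform : forall e, 0 < e -> exists d, 0 < d /\ forall x s t,
    0 <= s <= 1 -> 0 <= t <= 1 -> Rabs (s - t) < d -> Rabs (V O O x s - V O O x t) < e
}.

(** With [XInv] for 1 / (1 + u_xx) as an atom, the rational expressions produced by d/dy remain
    polynomials. *)
Inductive xatom : Type := XV (a b : nat) | XInv.

Definition xdx (a : xatom) : poly xatom :=
  match a with
  | XV a b => PAtom (XV (S a) b)
  | XInv => POpp (PMul (PMul (PAtom XInv) (PAtom XInv)) (PAtom (XV 3 0)))
  end.

Definition xdt (a : xatom) : poly xatom :=
  match a with
  | XV a b => PAtom (XV a (S b))
  | XInv => POpp (PMul (PMul (PAtom XInv) (PAtom XInv)) (PAtom (XV 2 1)))
  end.

Definition xdy (p : poly xatom) : poly xatom := PMul (PAtom XInv) (deriv xdx p).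

Definition xenv (V : nat -> nat -> R -> R -> R) (x t : R) (a : xatom) : R :=
  match a with
  | XV a b => V a b x t
  | XInv => / (1 + V 2%nat O x t)
  end.

(* With [psi] the Legendre transform of [u + x^2/2] in [x] and [y = x + u_x], the operator
   [d/dy] at fixed [t] reads [(1 + u_xx)^-1 d/dx].  So [Pf k] is [d_y^(k+2) psi] and [Qf k] is
   [- d_y^k d_t psi], both as functions of [(x, t)]. *)
Definition Pf (V : nat -> nat -> R -> R -> R) (k : nat) (x t : R) : R :=
  eval (xenv V x t) (Nat.iter k xdy (PAtom XInv)).

Definition Qf (V : nat -> nat -> R -> R -> R) (k : nat) (x t : R) : R :=
  eval (xenv V x t) (Nat.iter k xdy (PAtom (XV 0 1))).

Definition slope (V : nat -> nat -> R -> R -> R) (x t : R) : R := V 1%nat O x t + x.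

Definition inv_slope (V : nat -> nat -> R -> R -> R) (y t : R) : R :=
  epsilon (inhabits 0) (fun x => slope V x t = y).

Section Legendre.

Variables (eps : R) (V : nat -> nat -> R -> R -> R).
Hypothesis (HV : solution_jet eps V).

Notation X := (inv_slope V).
Notation Z x t := (1 + V 2%nat O x t).

Lemma Z_neq_0 (x t : R) : 0 <= t <= 1 -> Z x t <> 0.
Proof. intros It. pose proof (sj_convex _ _ HV x t It). lra. Qed.

Lemma V_dx_periodic (a : nat) (x t : R) : 0 <= t <= 1 -> V a O (x + 1) t = V a O x t.
Proof.
  intros It. revert x. induction a as [|a IH]; intros x; [now apply (sj_periodic _ _ HV)|].
  rewrite <- (is_derive_unique _ _ _ (sj_dx _ _ HV a O x t It)).
  symmetry. apply is_derive_unique.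
  apply (is_derive_ext (fun z => V a O (z + 1) t)); [exact IH|].
  apply (is_derive_shift (fun z => V a O z t)). now apply (sj_dx _ _ HV).
Qed.

Lemma is_derive_slope (x t : R) : 0 <= t <= 1 -> is_derive (fun z => slope V z t) x (Z x t).
Proof.
  intros It. unfold slope. rewrite Rplus_comm.
  apply @is_derive_plus; [now apply (sj_dx _ _ HV)|apply @is_derive_id].
Qed.

Lemma slope_increasing (t a b : R) : 0 <= t <= 1 -> a < b -> slope V a t < slope V b t.
Proof.
  intros It. apply (strictly_increasing_of_derive (fun z => slope V z t) (fun z => Z z t)).
  - intros x. now apply is_derive_slope.
  - intros x. now apply (sj_convex _ _ HV).
Qed.

Lemma slope_injective (t a b : R) : 0 <= t <= 1 -> slope V a t = slope V b t -> a = b.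
Proof.
  intros It E. destruct (Rtotal_order a b) as [L|[L|L]]; [|exact L|];
    apply (slope_increasing t) in L; lra.
Qed.

Lemma slope_periodic (x t : R) : 0 <= t <= 1 -> slope V (x + 1) t = slope V x t + 1.
Proof. intros It. unfold slope. rewrite V_dx_periodic by exact It. ring. Qed.

(* By Rolle, [u_x] vanishes in every period, and [x + u_x] is increasing. *)
Lemma V10_bound (x t : R) : 0 <= t <= 1 -> Rabs (V 1%nat O x t) <= 1.
Proof.
  intros It.
  assert (H : forall x, exists c, x < c < x + 1 /\ V 1%nat O c t = 0).
  { intros a. destruct (mean_value (fun z => V O O z t) (fun z => V 1%nat O z t) a (a + 1))
      as [c [Ic Ec]]; [lra| |].
    - intros z _. now apply (sj_dx _ _ HV).
    - exists c. split; [exact Ic|]. rewrite V_dx_periodic in Ec by exact It. lra. }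
  destruct (H x) as [c [Ic Ec]]. destruct (H (x - 1)) as [c' [Ic' Ec']].
  pose proof (slope_increasing t x c It (proj1 Ic)) as A1.
  assert (A2 : c' < x) by lra. apply (slope_increasing t) in A2; [|exact It].
  unfold slope in A1, A2. apply Rabs_le. lra.
Qed.

(** As |u_x| <= 1, the slope is at most [y] at y - 1 and at least [y] at y + 1. *)
Lemma slope_inv_slope (y t : R) : 0 <= t <= 1 -> slope V (X y t) t = y.
Proof.
  intros It. unfold inv_slope. apply epsilon_spec.
  pose proof (V10_bound (y - 1) t It) as A1. pose proof (V10_bound (y + 1) t It) as A2.
  apply Rabs_le_between in A1. apply Rabs_le_between in A2.
  destruct (IVT_gen (fun z => slope V z t) (y - 1) (y + 1) y) as [x [_ Ex]].
  - intros x. eapply is_derive_continuity_pt. now apply is_derive_slope.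
  - unfold slope. rewrite Rmin_left, Rmax_right; lra.
  - now exists x.
Qed.

Lemma inv_slope_slope (x t : R) : 0 <= t <= 1 -> X (slope V x t) t = x.
Proof. intros It. apply (slope_injective t); [exact It|]. now apply slope_inv_slope. Qed.

Lemma inv_slope_near (y t : R) : 0 <= t <= 1 -> Rabs (X y t - y) <= 1.
Proof.
  intros It. rewrite Rabs_minus_sym. pose proof (slope_inv_slope y t It) as E. unfold slope in E.
  replace (y - X y t) with (V 1%nat O (X y t) t) by lra. now apply V10_bound.
Qed.

Lemma inv_slope_periodic (y t : R) : 0 <= t <= 1 -> X (y + 1) t = X y t + 1.
Proof.
  intros It. apply (slope_injective t); [exact It|].
  now rewrite slope_periodic, !slope_inv_slope by exact It.
Qed.

Lemma is_derive_xenv_dx (x t : R) (p : poly xatom) : 0 <= t <= 1 ->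
  is_derive (fun z => eval (xenv V z t) p) x (eval (xenv V x t) (deriv xdx p)).
Proof.
  intros It. apply (is_derive_eval (fun z => xenv V z t)). intros [a b|]; simpl.
  - now apply (sj_dx _ _ HV).
  - evar_last.
    + apply is_derive_inv; [|now apply Z_neq_0].
      apply @is_derive_plus; [apply @is_derive_const|now apply (sj_dx _ _ HV)].
    + unfold plus, zero; simpl. field. now apply Z_neq_0.
Qed.

Lemma is_derive_xenv_dt (x t : R) (p : poly xatom) : 0 < t < 1 ->
  is_derive (fun s => eval (xenv V x s) p) t (eval (xenv V x t) (deriv xdt p)).
Proof.
  intros It. apply (is_derive_eval (fun s => xenv V x s)). intros [a b|]; simpl.
  - now apply (sj_dt _ _ HV).
  - evar_last.
    + apply is_derive_inv; [|apply Z_neq_0; lra].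
      apply @is_derive_plus; [apply @is_derive_const|now apply (sj_dt _ _ HV)].
    + unfold plus, zero; simpl. field. apply Z_neq_0; lra.
Qed.

Lemma is_derive_inv_slope_dy (y t : R) : 0 <= t <= 1 ->
  is_derive (fun z => X z t) y (/ Z (X y t) t).
Proof.
  intros It.
  (* The shape [- Fs / Fx] for F x s = slope V x t - s, with [y] as the parameter. *)
  replace (/ Z (X y t) t) with (- -1 / Z (X y t) t) by (field; now apply Z_neq_0).
  apply (implicit_derive (fun x s => slope V x t - s) (fun x s => Z x t) (fun x s => -1)
           (fun z => X z t) y 1); [lra| | | | | |].
  - intros s _. rewrite slope_inv_slope by exact It. ring.
  - intros x s _. rewrite <- (Rminus_0_r (Z x t)).
    apply @is_derive_minus; [now apply is_derive_slope|apply @is_derive_const].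
  - intros x s _. auto_derive; [trivial|ring].
  - intros x s _. now apply (sj_convex _ _ HV).
  - apply (continuity_2d_pt_of_1d (fun x => Z x t)). eapply is_derive_continuity_pt.
    apply @is_derive_plus; [apply @is_derive_const|now apply (sj_dx _ _ HV)].
  - apply continuity_2d_pt_const.
Qed.

Lemma is_derive_inv_slope_dt (y t : R) : 0 < t < 1 ->
  is_derive (X y) t (- V 1%nat 1%nat (X y t) t / Z (X y t) t).
Proof.
  intros It.
  assert (Hs : forall s, Rabs (s - t) < Rmin t (1 - t) -> 0 < s < 1).
  { intros s Hs. pose proof (Rmin_l t (1 - t)). pose proof (Rmin_r t (1 - t)).
    apply Rabs_def2 in Hs. lra. }
  apply (implicit_derive (fun x s => slope V x s - y) (fun x s => Z x s)
           (fun x s => V 1%nat 1%nat x s) (X y) t (Rmin t (1 - t))).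
  - apply Rmin_pos; lra.
  - intros s Is. apply Hs in Is. rewrite slope_inv_slope by lra. ring.
  - intros x s Is. apply Hs in Is. rewrite <- (Rminus_0_r (Z x s)).
    apply @is_derive_minus; [apply is_derive_slope; lra|apply @is_derive_const].
  - intros x s Is. apply Hs in Is. unfold slope. evar_last.
    + apply @is_derive_minus; [apply @is_derive_plus|]; [now apply (sj_dt _ _ HV)| |];
        apply @is_derive_const.
    + unfold minus, plus, opp, zero; simpl. ring.
  - intros x s Is. apply Hs in Is. apply (sj_convex _ _ HV). lra.
  - apply continuity_2d_pt_plus; [apply continuity_2d_pt_const|now apply (sj_continuous _ _ HV)].
  - now apply (sj_continuous _ _ HV).
Qed.

Lemma is_derive_at_inv_slope_dy (f : R -> R) (l y t : R) : 0 <= t <= 1 ->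
  is_derive f (X y t) l -> is_derive (fun z => f (X z t)) y (/ Z (X y t) t * l).
Proof.
  intros It Hf. apply (is_derive_comp f (fun z => X z t)); [exact Hf|].
  now apply is_derive_inv_slope_dy.
Qed.

(** Joint differentiability, required by the chain rule along (X y s, s), follows from the
    continuity of one of the two partial derivatives. *)
Lemma V_differentiable (a b : nat) (x t : R) : 0 < t < 1 ->
  differentiable_pt_lim (V a b) x t (V (S a) b x t) (V a (S b) x t).
Proof.
  intros It. apply filterdiff_differentiable_pt_lim.
  assert (Hloc : locally (x, t) (fun z : R * R => 0 < snd z < 1)).
  { apply (locally_2d_locally (fun _ v => 0 < v < 1)). now apply locally_2d_strip. }
  apply (is_derive_filterdiff (V a b) x t (fun u v => V (S a) b u v) (V a (S b) x t)).
  - revert Hloc. apply filter_imp. intros [u v] Iv. simpl in *.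
    apply (sj_dx _ _ HV). lra.
  - now apply (sj_dt _ _ HV).
  - apply (continuity_2d_pt_filterlim (V (S a) b)). now apply (sj_continuous _ _ HV).
Qed.

Lemma is_derive_V_at_inv_slope_dt (a b : nat) (y t : R) : 0 < t < 1 ->
  is_derive (fun s => V a b (X y s) s) t
    (V (S a) b (X y t) t * (- V 1%nat 1%nat (X y t) t / Z (X y t) t) + V a (S b) (X y t) t).
Proof.
  intros It. apply is_derive_Reals.
  rewrite <- (Rmult_1_r (V a (S b) (X y t) t)).
  apply (derivable_pt_lim_comp_2d (V a b) (X y) (fun s => s)).
  - now apply V_differentiable.
  - apply is_derive_Reals. now apply is_derive_inv_slope_dt.
  - apply derivable_pt_lim_id.
Qed.

End Legendre.

(* [transform k] is [d_y^k (psi - y^2/2 + eps t^2/2)], and [transform_dt k] its time derivative;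
   the two corrections make the function periodic and the linear equation homogeneous. *)
Definition transform (eps : R) (V : nat -> nat -> R -> R -> R) (k : nat) (y t : R) : R :=
  let x := inv_slope V y t in
  match k with
  | O => y * x - V O O x t - x ^ 2 / 2 - y ^ 2 / 2 + eps * t ^ 2 / 2
  | 1%nat => x - y
  | 2%nat => Pf V O x t - 1
  | S (S j) => Pf V j x t
  end.

Definition transform_dt (eps : R) (V : nat -> nat -> R -> R -> R) (k : nat) (y t : R) : R :=
  match k with
  | O => eps * t - V O 1%nat (inv_slope V y t) t
  | S _ => - Qf V k (inv_slope V y t) t
  end.

Lemma is_derive_transform_dy_aux (X F : R -> R) (y l m c : R) :
  is_derive X y l -> is_derive F y m ->
  is_derive (fun z => z * X z - F z - X z ^ 2 / 2 - z ^ 2 / 2 + c) y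
    (X y + y * l - m - X y * l - y).
Proof.
  intros HX HF. auto_derive.
  - repeat split; eexists; eassumption.
  - replace (Derive (fun z : R => X z) y) with l by (symmetry; now apply is_derive_unique).
    replace (Derive (fun z : R => F z) y) with m by (symmetry; now apply is_derive_unique).
    field.
Qed.

Lemma is_derive_transform_dt_aux (X F : R -> R) (y t l m eps : R) :
  is_derive X t l -> is_derive F t m ->
  is_derive (fun s => y * X s - F s - X s ^ 2 / 2 - y ^ 2 / 2 + eps * s ^ 2 / 2) t
    (y * l - m - X t * l + eps * t).
Proof.
  intros HX HF. auto_derive.
  - repeat split; eexists; eassumption.
  - replace (Derive (fun z : R => X z) t) with l by (symmetry; now apply is_derive_unique).
    replace (Derive (fun z : R => F z) t) with m by (symmetry; now apply is_derive_unique).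
    field.
Qed.

Section Transform.

Variables (eps : R) (V : nat -> nat -> R -> R -> R).
Hypothesis (HV : solution_jet eps V).

Notation X := (inv_slope V).
Notation Z x t := (1 + V 2%nat O x t).

Lemma eval_deriv_xdx (p : poly xatom) (x t : R) : 0 <= t <= 1 ->
  eval (xenv V x t) (deriv xdx p) = Z x t * eval (xenv V x t) (xdy p).
Proof. intros It. simpl. field. now apply (Z_neq_0 _ _ HV). Qed.

Lemma Pf_dx (k : nat) (x t : R) : 0 <= t <= 1 ->
  is_derive (fun z => Pf V k z t) x (Z x t * Pf V (S k) x t).
Proof.
  intros It. unfold Pf. simpl Nat.iter. rewrite <- eval_deriv_xdx by exact It.
  now apply (is_derive_xenv_dx eps).
Qed.

Lemma Qf_dx (k : nat) (x t : R) : 0 <= t <= 1 ->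
  is_derive (fun z => Qf V k z t) x (Z x t * Qf V (S k) x t).
Proof.
  intros It. unfold Qf. simpl Nat.iter. rewrite <- eval_deriv_xdx by exact It.
  now apply (is_derive_xenv_dx eps).
Qed.

Lemma is_derive_at_inv_slope (f : R -> R) (l y t : R) : 0 <= t <= 1 ->
  is_derive f (X y t) (Z (X y t) t * l) -> is_derive (fun z => f (X z t)) y l.
Proof.
  intros It Hf. replace l with (/ Z (X y t) t * (Z (X y t) t * l)).
  - now apply (is_derive_at_inv_slope_dy eps).
  - field. now apply (Z_neq_0 _ _ HV).
Qed.

Lemma transform_dy (k : nat) (y t : R) : 0 <= t <= 1 ->
  is_derive (fun z => transform eps V k z t) y (transform eps V (S k) y t).
Proof.
  intros It. pose proof (is_derive_inv_slope_dy _ _ HV y t It) as HX.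
  pose proof (Z_neq_0 _ _ HV (X y t) t It) as HZ.
  destruct k as [|[|[|k]]]; simpl transform.
  - pose proof (slope_inv_slope _ _ HV y t It) as E. unfold slope in E. evar_last.
    + apply (is_derive_transform_dy_aux (fun z => X z t) (fun z => V O O (X z t) t)); [exact HX|].
      apply (is_derive_at_inv_slope_dy _ _ HV (fun z => V O O z t)); [exact It|].
      now apply (sj_dx _ _ HV).
    (* Envelope identity: the terms carrying the derivative of [X] cancel because y = x + u_x. *)
    + simpl. rewrite <- E at 2. field. exact HZ.
  - unfold Pf. simpl. apply @is_derive_minus; [exact HX|apply @is_derive_id].
  - replace (Pf V 1 (X y t) t) with (Pf V 1 (X y t) t - 0) by ring.
    apply @is_derive_minus; [|apply @is_derive_const].
    apply (is_derive_at_inv_slope (fun z => Pf V O z t)); [exact It|now apply Pf_dx].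
  - apply (is_derive_at_inv_slope (fun z => Pf V (S k) z t)); [exact It|now apply Pf_dx].
Qed.

Lemma transform_dt_dy (k : nat) (y t : R) : 0 < t < 1 ->
  is_derive (fun z => transform_dt eps V k z t) y (transform_dt eps V (S k) y t).
Proof.
  intros It. assert (It' : 0 <= t <= 1) by lra. destruct k as [|k]; simpl transform_dt.
  - rewrite <- Rminus_0_l. apply @is_derive_minus; [apply @is_derive_const|].
    apply (is_derive_at_inv_slope (fun z => V O 1%nat z t)); [exact It'|].
    now apply (Qf_dx 0).
  - apply @is_derive_opp.
    apply (is_derive_at_inv_slope (fun z => Qf V (S k) z t)); [exact It'|now apply Qf_dx].
Qed.

(** The function of [x] has derivative y - slope, which decreases and vanishes at [X y t]. Being a
    maximum, the transform can be compared at two times without controlling [X] in time. *)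
Lemma legendre_maximal (x y t : R) : 0 <= t <= 1 ->
  y * x - V O O x t - x ^ 2 / 2 <= y * X y t - V O O (X y t) t - X y t ^ 2 / 2.
Proof.
  intros It.
  assert (Hd : forall z, is_derive (fun z => y * z - V O O z t - z ^ 2 / 2) z (y - slope V z t)).
  { intros z. pose proof (sj_dx _ _ HV O O z t It) as D. auto_derive.
    - repeat split. eexists; exact D.
    - replace (Derive (fun z : R => V O O z t) z) with (V 1%nat O z t)
        by (symmetry; apply is_derive_unique, D).
      unfold slope. field. }
  pose proof (slope_inv_slope _ _ HV y t It) as E.
  destruct (Rtotal_order x (X y t)) as [L|[<-|L]]; [|apply Rle_refl|].
  - destruct (mean_value _ _ x (X y t) L (fun z _ => Hd z)) as [c [Ic Ec]].
    pose proof (slope_increasing _ _ HV t c (X y t) It (proj2 Ic)).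
    assert (0 <= (y - slope V c t) * (X y t - x)) by (apply Rmult_le_pos; lra). lra.
  - destruct (mean_value _ _ (X y t) x L (fun z _ => Hd z)) as [c [Ic Ec]].
    pose proof (slope_increasing _ _ HV t (X y t) c It (proj1 Ic)).
    assert (0 <= (slope V c t - y) * (x - X y t)) by (apply Rmult_le_pos; lra). lra.
Qed.

(** In [y] the transform is 1-Lipschitz, its derivative being X - y. In [t] it inherits the modulus
    of [u]: the maximiser for one time is a competitor for the other. The term eps t^2 / 2 takes the
    last third of [e]. *)
Lemma transform_uniformly_continuous : strip_uniformly_continuous (transform eps V O).
Proof.
  intros e He. pose proof (sj_eps _ _ HV) as Hep.
  destruct (sj_uniform _ _ HV (e / 3)) as [d [Hd Hu]]; [lra|].
  assert (H3 : 0 < e / (3 * eps)) by (apply Rdiv_lt_0_compat; lra).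
  exists (Rmin d (Rmin (e / 3) (e / (3 * eps)))).
  pose proof (Rmin_l d (Rmin (e / 3) (e / (3 * eps)))).
  pose proof (Rmin_r d (Rmin (e / 3) (e / (3 * eps)))).
  pose proof (Rmin_l (e / 3) (e / (3 * eps))). pose proof (Rmin_r (e / 3) (e / (3 * eps))).
  split; [repeat apply Rmin_pos; lra|].
  intros y z s t Is It Hyz Hst.
  assert (A1 : Rabs (transform eps V O z s - transform eps V O y s) <= 1 * Rabs (z - y)).
  { apply (bounded_variation (fun z => transform eps V O z s) (fun z => transform eps V 1 z s)).
    intros c _. split; [now apply transform_dy|]. now apply (inv_slope_near eps). }
  rewrite (Rabs_minus_sym z y) in A1.
  assert (A2 : forall a b, 0 <= a <= 1 -> 0 <= b <= 1 -> Rabs (a - b) < d ->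
    z * X z a - V O O (X z a) a - X z a ^ 2 / 2 <
    z * X z b - V O O (X z b) b - X z b ^ 2 / 2 + e / 3).
  { intros a b Ia Ib Hab. pose proof (legendre_maximal (X z a) z b Ib) as L.
    specialize (Hu (X z a) a b Ia Ib Hab). apply Rabs_def2 in Hu. lra. }
  assert (A3 : Rabs (eps * s ^ 2 / 2 - eps * t ^ 2 / 2) < e / 3).
  { replace (eps * s ^ 2 / 2 - eps * t ^ 2 / 2) with (eps * ((s - t) * ((s + t) / 2))) by field.
    rewrite !Rabs_mult, (Rabs_pos_eq eps), (Rabs_pos_eq ((s + t) / 2)) by lra.
    replace (e / 3) with (eps * (e / (3 * eps))) by (field; lra).
    apply Rmult_lt_compat_l; [lra|]. apply Rle_lt_trans with (Rabs (s - t) * 1); [|lra].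
    apply Rmult_le_compat_l; [apply Rabs_pos|lra]. }
  pose proof (A2 s t Is It ltac:(lra)) as B1.
  pose proof (A2 t s It Is ltac:(rewrite Rabs_minus_sym; lra)) as B2.
  apply Rabs_le_between in A1. apply Rabs_def2 in A3.
  apply Rabs_def1; simpl transform in *; lra.
Qed.

Lemma transform_harmonic :
  strip_harmonic eps (transform eps V O) (transform eps V 1) (transform eps V 2)
    (transform_dt eps V O) (fun y t => eps - eps * Pf V O (X y t) t).
Proof.
  constructor.
  - intros y t It. simpl. rewrite (inv_slope_periodic _ _ HV) by exact It.
    rewrite (sj_periodic _ _ HV) by exact It. field.
  - apply transform_uniformly_continuous.
  - intros y t It. apply transform_dy. lra.
  - intros y t It. apply transform_dy. lra.
  - intros y t It. assert (It' : 0 <= t <= 1) by lra.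
    pose proof (slope_inv_slope _ _ HV y t It') as E. unfold slope in E.
    simpl transform. simpl transform_dt. evar_last.
    + apply (is_derive_transform_dt_aux (X y) (fun s => V O O (X y s) s)).
      * now apply (is_derive_inv_slope_dt eps).
      * now apply (is_derive_V_at_inv_slope_dt eps).
    + rewrite <- E at 1. field. now apply (Z_neq_0 _ _ HV).
  - intros y t It. assert (It' : 0 <= t <= 1) by lra. simpl transform_dt. evar_last.
    + apply @is_derive_minus; [|now apply (is_derive_V_at_inv_slope_dt eps)].
      apply is_derive_scal. apply @is_derive_id.
    + pose proof (sj_equation _ _ HV (X y t) t It) as E.
      unfold Pf, minus, plus, opp, one; simpl. rewrite <- E. field. now apply (Z_neq_0 _ _ HV).
  - intros y t It. simpl. ring.
Qed.

(* The time derivative at fixed [x] differs from the one at fixed [y] by [V 1 1] times the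
   [y]-derivative; the latter two commute. *)
Lemma xdt_xdy (p : poly xatom) (r : R -> R) (r' x t : R) : 0 < t < 1 ->
  (forall z, eval (xenv V z t) (deriv xdt p) =
     r z + V 1%nat 1%nat z t * eval (xenv V z t) (xdy p)) ->
  is_derive r x (Z x t * r') ->
  eval (xenv V x t) (deriv xdt (xdy p)) =
    r' + V 1%nat 1%nat x t * eval (xenv V x t) (xdy (xdy p)).
Proof.
  intros It Hp Hr. assert (It' : 0 <= t <= 1) by lra.
  pose proof (Z_neq_0 _ _ HV x t It') as HZ.
  (* After exchanging the formal derivations, [Hp], valid at every [z], is differentiated in [x]. *)
  assert (Hc : eval (xenv V x t) (deriv xdt (deriv xdx p)) =
    Z x t * r' + (V 2%nat 1%nat x t * eval (xenv V x t) (xdy p)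
      + V 1%nat 1%nat x t * eval (xenv V x t) (deriv xdx (xdy p)))).
  { rewrite eval_deriv_comm by (intros [a b|]; simpl; ring).
    rewrite <- (is_derive_unique _ _ _ (is_derive_xenv_dx _ _ HV x t (deriv xdt p) It')).
    apply is_derive_unique.
    apply (is_derive_ext (fun z => r z + V 1%nat 1%nat z t * eval (xenv V z t) (xdy p)));
      [intros z; now rewrite Hp|].
    apply @is_derive_plus; [exact Hr|].
    apply (Derive.is_derive_mult (fun z => V 1%nat 1%nat z t)
             (fun z => eval (xenv V z t) (xdy p))); [now apply (sj_dx _ _ HV)|now apply (is_derive_xenv_dx eps)]. }
  rewrite eval_deriv_xdx in Hc by exact It'.
  (* The product rule on [xdy p]: its [V 2 1] term cancels the one in [Hc]. *)
  change (eval (xenv V x t) (deriv xdt (xdy p))) with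
    (- (/ Z x t * / Z x t * V 2%nat 1%nat x t) * eval (xenv V x t) (deriv xdx p)
      + / Z x t * eval (xenv V x t) (deriv xdt (deriv xdx p))).
  rewrite Hc, eval_deriv_xdx by exact It'. field. exact HZ.
Qed.

Lemma V11_Qf (x t : R) : 0 <= t <= 1 -> V 1%nat 1%nat x t = Z x t * Qf V 1 x t.
Proof. intros It. unfold Qf. simpl. field. now apply (Z_neq_0 _ _ HV). Qed.

(** For k = 0 this is the equation solved for u_tt; [xdt_xdy] raises [k]. The second term is the
    shear u_xt d_y. *)
Lemma Qf_dt (k : nat) (x t : R) : 0 < t < 1 ->
  is_derive (Qf V k x) t (eps * Pf V k x t + Z x t * Qf V 1 x t * Qf V (S k) x t).
Proof.
  intros It. evar_last; [now apply (is_derive_xenv_dt eps)|].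
  rewrite <- V11_Qf by lra. revert x. induction k as [|k IH]; intros x.
  - unfold Pf, Qf. simpl. rewrite <- (sj_equation _ _ HV x t It). field.
    apply (Z_neq_0 _ _ HV). lra.
  - apply (xdt_xdy _ (fun z => eps * Pf V k z t)); [exact It|exact IH|].
    replace (Z x t * (eps * Pf V (S k) x t)) with (eps * (Z x t * Pf V (S k) x t)) by ring.
    apply is_derive_scal, Pf_dx. lra.
Qed.

(** Equality of d_t d_y^(k+2) psi and d_y^(k+2) d_t psi, plus the shear. The base case is pure
    calculus. *)
Lemma Pf_dt (k : nat) (x t : R) : 0 < t < 1 ->
  is_derive (Pf V k x) t (- Qf V (S (S k)) x t + Z x t * Qf V 1 x t * Pf V (S k) x t).
Proof.
  intros It. evar_last; [now apply (is_derive_xenv_dt eps)|].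
  rewrite <- V11_Qf by lra. revert x. induction k as [|k IH]; intros x.
  - unfold Pf, Qf. simpl. field. apply (Z_neq_0 _ _ HV). lra.
  - apply (xdt_xdy _ (fun z => - Qf V (S (S k)) z t)); [exact It|exact IH|].
    rewrite <- Ropp_mult_distr_r. apply @is_derive_opp, Qf_dx. lra.
Qed.

End Transform.

(* Polynomials in these atoms are closed under [d_x] and [d_t], and every atom is bounded
   uniformly in [eps]. *)
Inductive yatom : Type := YP (k : nat) | YQ (k : nat) | YZ | YEps.

(** [YZ] is differentiated as the inverse of [YP 0], which keeps u_xxx and u_xxt out of the
    atoms. *)
Definition ydx (a : yatom) : poly yatom :=
  match a with
  | YP k => PMul (PAtom YZ) (PAtom (YP (S k)))
  | YQ k => PMul (PAtom YZ) (PAtom (YQ (S k)))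
  | YZ => POpp (PMul (PMul (PAtom YZ) (PAtom YZ)) (PMul (PAtom YZ) (PAtom (YP 1))))
  | YEps => PConst 0
  end.

Definition ydt (a : yatom) : poly yatom :=
  let shear := PMul (PAtom YZ) (PAtom (YQ 1)) in
  match a with
  | YP k => PAdd (POpp (PAtom (YQ (S (S k))))) (PMul shear (PAtom (YP (S k))))
  | YQ k => PAdd (PMul (PAtom YEps) (PAtom (YP k))) (PMul shear (PAtom (YQ (S k))))
  | YZ => POpp (PMul (PMul (PAtom YZ) (PAtom YZ))
            (PAdd (POpp (PAtom (YQ 2))) (PMul shear (PAtom (YP 1)))))
  | YEps => PConst 0
  end.

Definition yenv (eps : R) (V : nat -> nat -> R -> R -> R) (x t : R) (a : yatom) : R :=
  match a with
  | YP k => Pf V k x t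
  | YQ k => Qf V k x t
  | YZ => 1 + V 2%nat O x t
  | YEps => eps
  end.

(** The starting points are u_xx = [YZ] - 1 and u_t = [YQ 0]. For b = 0 the subtraction truncates,
    so [V_poly_correct] excludes u and u_x through 2 <= a + 2 b. *)
Definition V_poly (a b : nat) : poly yatom :=
  match b with
  | O => Nat.iter (a - 2) (deriv ydx) (PAdd (PAtom YZ) (PConst (-1)))
  | S b => Nat.iter a (deriv ydx) (Nat.iter b (deriv ydt) (PAtom (YQ 0)))
  end.

Section Representation.

Variables (eps : R) (V : nat -> nat -> R -> R -> R).
Hypothesis (HV : solution_jet eps V).

Lemma is_derive_yenv_dx (p : poly yatom) (x t : R) : 0 <= t <= 1 ->
  is_derive (fun z => eval (yenv eps V z t) p) x (eval (yenv eps V x t) (deriv ydx p)).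
Proof.
  intros It. apply (is_derive_eval (fun z => yenv eps V z t)). intros [k|k| |]; simpl.
  - now apply (Pf_dx eps).
  - now apply (Qf_dx eps).
  - pose proof (Pf_dx _ _ HV 0 x t It) as D. pose proof (Z_neq_0 _ _ HV x t It) as HZ.
    apply (is_derive_ext (fun z => / Pf V 0 z t)).
    { intros z. unfold Pf. simpl. apply Rinv_inv. }
    evar_last; [apply is_derive_inv; [exact D|unfold Pf; simpl; now apply Rinv_neq_0_compat]|].
    unfold Pf at 2. simpl. field. exact HZ.
  - apply @is_derive_const.
Qed.

Lemma is_derive_yenv_dt (p : poly yatom) (x t : R) : 0 < t < 1 ->
  is_derive (fun s => eval (yenv eps V x s) p) t (eval (yenv eps V x t) (deriv ydt p)).
Proof.
  intros It. apply (is_derive_eval (fun s => yenv eps V x s)). intros [k|k| |]; simpl.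
  - now apply (Pf_dt eps).
  - now apply Qf_dt.
  - pose proof (Pf_dt _ _ HV 0 x t It) as D.
    assert (HZ : 1 + V 2%nat O x t <> 0) by (apply (Z_neq_0 _ _ HV); lra).
    apply (is_derive_ext (fun s => / Pf V 0 x s)).
    { intros s. unfold Pf. simpl. apply Rinv_inv. }
    evar_last; [apply is_derive_inv; [exact D|unfold Pf; simpl; now apply Rinv_neq_0_compat]|].
    unfold Pf at 2. simpl. field. exact HZ.
  - apply @is_derive_const.
Qed.

Lemma V_poly_correct (a b : nat) (x t : R) : (2 <= a + 2 * b)%nat -> 0 < t < 1 ->
  V a b x t = eval (yenv eps V x t) (V_poly a b).
Proof.
  intros Hab It. assert (It' : 0 <= t <= 1) by lra.
  assert (Hx : forall a b p, (forall x, V a b x t = eval (yenv eps V x t) p) ->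
    forall n x, V (n + a)%nat b x t = eval (yenv eps V x t) (Nat.iter n (deriv ydx) p)).
  { clear a b x Hab. intros a b p H n. induction n as [|n IH]; intros x; [apply H|]. simpl.
    rewrite <- (is_derive_unique _ _ _ (is_derive_yenv_dx _ x t It')).
    symmetry. apply is_derive_unique.
    apply (is_derive_ext (fun z => V (n + a)%nat b z t)); [exact IH|].
    now apply (sj_dx _ _ HV). }
  destruct b as [|b]; simpl V_poly.
  - replace a with (a - 2 + 2)%nat at 1 by lia. apply Hx. intros z. simpl. ring.
  - replace a with (a + 0)%nat at 1 by lia. apply Hx. clear x Hab Hx a It'. intros x.
    revert t It. induction b as [|b IH]; intros t It; [reflexivity|]. simpl.
    rewrite <- (is_derive_unique _ _ _ (is_derive_yenv_dt _ x t It)).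
    symmetry. apply is_derive_unique.
    apply (is_derive_ext_loc (fun s => V O (S b) x s)).
    + apply (locally_interval _ t 0 1); try apply It. intros s Hs0 Hs1. now apply IH.
    + now apply (sj_dt _ _ HV).
Qed.

End Representation.

(** * Uniform bounds *)

Record bounds : Type := { bd_eps : R; bd_lambda : R; bd_K : R }.

(** All that the constants may depend on is in [M] and [th]. Through [ct_zero] every atom has a
    bound at t = 0 and t = 1, so boundary polynomials can be treated uniformly. *)
Record controlled (M : nat) (th : bounds) (eps : R) (V : nat -> nat -> R -> R -> R) : Prop := {
  ct_jet : solution_jet eps V;
  ct_eps : eps <= bd_eps th;
  ct_lambda : 0 < bd_lambda th;
  ct_convex : forall x t, t = 0 \/ t = 1 -> bd_lambda th <= 1 + V 2%nat O x t;
  ct_bound : forall a x t, t = 0 \/ t = 1 -> (a <= M)%nat -> Rabs (V a O x t) <= bd_K th;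
  ct_zero : forall a b x t, t = 0 \/ t = 1 -> V a (S b) x t = 0
}.

Lemma controlled_le (M M' : nat) (th : bounds) (eps : R) (V : nat -> nat -> R -> R -> R) :
  (M <= M')%nat -> controlled M' th eps V -> controlled M th eps V.
Proof.
  intros HM [H1 H2 H3 H4 H5 H6]. constructor; try assumption.
  intros a x t Ht Ha. apply H5; [exact Ht|lia].
Qed.

Lemma boundary_poly_bound (p : poly xatom) :
  exists M, forall th, exists C, forall eps V x t,
    controlled M th eps V -> t = 0 \/ t = 1 -> Rabs (eval (xenv V x t) p) <= C.
Proof.
  destruct (poly_bound (fun M th rho => exists eps V x t,
    controlled M th eps V /\ (t = 0 \/ t = 1) /\ rho = xenv V x t)) with (p := p) as [M HM].
  - intros M M' th rho HMM [eps [V [x [t [Hc H]]]]]. exists eps, V, x, t.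
    split; [now apply (controlled_le M M')|exact H].
  - intros [a [|b]|].
    + exists a. intros th. exists (bd_K th). intros rho [eps [V [x [t [Hc [Ht ->]]]]]].
      now apply (ct_bound _ _ _ _ Hc).
    + exists O. intros th. exists 0. intros rho [eps [V [x [t [Hc [Ht ->]]]]]]. simpl.
      rewrite (ct_zero _ _ _ _ Hc) by exact Ht. rewrite Rabs_R0. apply Rle_refl.
    + exists O. intros th. exists (/ bd_lambda th). intros rho [eps [V [x [t [Hc [Ht ->]]]]]]. simpl.
      pose proof (ct_convex _ _ _ _ Hc x t Ht). pose proof (ct_lambda _ _ _ _ Hc).
      rewrite Rabs_pos_eq by (left; apply Rinv_0_lt_compat; lra).
      apply Rinv_le_contravar; assumption.
  - exists M. intros th. destruct (HM th) as [C HC]. exists C. intros eps V x t Hc Ht.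
    apply HC. now exists eps, V, x, t.
Qed.

Lemma transform_bound (k : nat) :
  exists M, forall th, exists C, forall eps V,
    controlled M th eps V -> forall y t, 0 <= t <= 1 -> Rabs (transform eps V k y t) <= C.
Proof.
  assert (H : exists M, forall th, exists C, forall eps V,
    controlled M th eps V -> forall y t, t = 0 \/ t = 1 -> Rabs (transform eps V k y t) <= C).
  { destruct k as [|[|k]].
    (* The transform equals - u - (x - y)^2 / 2 + eps t^2 / 2, and |x - y| <= 1. *)
    - exists O. intros th. exists (bd_K th + 1 / 2 + bd_eps th / 2). intros eps V Hc y t Ht.
      pose proof (ct_jet _ _ _ _ Hc) as HV. pose proof (sj_eps _ _ HV).
      pose proof (ct_eps _ _ _ _ Hc).
      assert (It : 0 <= t <= 1) by lra.
      pose proof (ct_bound _ _ _ _ Hc O (inv_slope V y t) t Ht (le_n _)) as B0.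
      pose proof (inv_slope_near _ _ HV y t It) as B1. simpl transform.
      set (x := inv_slope V y t) in *. apply Rabs_le_between in B0. apply Rabs_le_between in B1.
      assert (B2 : (x - y) ^ 2 <= 1) by nra.
      assert (B3 : 0 <= eps * t ^ 2 <= bd_eps th) by (destruct Ht as [-> | ->]; lra).
      assert (0 <= (x - y) ^ 2) by apply pow2_ge_0.
      apply Rabs_le. lra.
    - exists O. intros th. exists 1. intros eps V Hc y t Ht.
      apply (inv_slope_near _ _ (ct_jet _ _ _ _ Hc)). lra.
    - destruct (boundary_poly_bound (Nat.iter k xdy (PAtom XInv))) as [M HM].
      exists M. intros th. destruct (HM th) as [C HC]. exists (C + 1). intros eps V Hc y t Ht.
      pose proof (HC eps V (inv_slope V y t) t Hc Ht) as B. fold (Pf V k (inv_slope V y t) t) in B.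
      destruct k as [|k]; [|simpl; lra]. simpl transform.
      apply Rabs_le_between in B. apply Rabs_le. lra. }
  destruct H as [M HM]. exists M. intros th. destruct (HM th) as [C HC]. exists C.
  intros eps V Hc. pose proof (ct_jet _ _ _ _ Hc) as HV.
  apply (harmonic_dy_bound eps C _ _ _ _ _ k (sj_eps _ _ HV) (transform_harmonic _ _ HV)).
  - intros i y t It. now apply transform_dy.
  - intros y. apply HC; [exact Hc|now left].
  - intros y. apply HC; [exact Hc|now right].
Qed.

Lemma Pf_bound (k : nat) :
  exists M, forall th, exists C, forall eps V,
    controlled M th eps V -> forall x t, 0 <= t <= 1 -> Rabs (Pf V k x t) <= C.
Proof.
  destruct (transform_bound (S (S k))) as [M HM]. exists M. intros th.
  destruct (HM th) as [C HC]. exists (C + 1). intros eps V Hc x t It.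
  specialize (HC eps V Hc (slope V x t) t It).
  destruct k as [|k]; simpl transform in HC;
    rewrite (inv_slope_slope _ _ (ct_jet _ _ _ _ Hc)) in HC by exact It; [|lra].
  apply Rabs_le_between in HC. apply Rabs_le. lra.
Qed.

(** 1 + u_xx is the inverse of psi_yy, whose boundary values are at least 1 / (1 + K); the minimum
    principle carries this bound inside. *)
Lemma Z_bound (th : bounds) (eps : R) (V : nat -> nat -> R -> R -> R) (x t : R) :
  controlled 2 th eps V -> 0 <= t <= 1 -> Rabs (1 + V 2%nat O x t) <= 1 + bd_K th.
Proof.
  intros Hc It. pose proof (ct_jet _ _ _ _ Hc) as HV.
  pose proof (sj_convex _ _ HV) as HZ.
  (* [bd_K] is an arbitrary real; its sign is read off from a quantity that it bounds. *)
  assert (HK : 0 < 1 + bd_K th).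
  { pose proof (ct_bound _ _ _ _ Hc O 0 0 (or_introl eq_refl) ltac:(lia)) as B.
    pose proof (Rabs_pos (V O O 0 0)). lra. }
  assert (Hb : forall y s, s = 0 \/ s = 1 -> / (1 + bd_K th) - 1 <= transform eps V 2 y s).
  { intros y s Hs. simpl. unfold Pf. simpl. apply Rplus_le_compat_r, Rinv_le_contravar.
    - apply HZ. lra.
    - apply Rplus_le_compat_l. eapply Rle_trans; [apply Rle_abs|].
      now apply (ct_bound _ _ _ _ Hc). }
  pose proof (harmonic_dy_ge eps (/ (1 + bd_K th) - 1) _ _ _ _ _ 2 (sj_eps _ _ HV)
    (transform_harmonic _ _ HV) (fun i y t It => transform_dy _ _ HV i y t It)
    (fun y => Hb y 0 (or_introl eq_refl)) (fun y => Hb y 1 (or_intror eq_refl))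
    (slope V x t) t It) as H.
  simpl transform in H. rewrite (inv_slope_slope _ _ HV) in H by exact It.
  unfold Pf in H. simpl in H. rewrite Rabs_pos_eq by (left; now apply HZ).
  rewrite <- (Rinv_inv (1 + V 2%nat O x t)), <- (Rinv_inv (1 + bd_K th)).
  apply Rinv_le_contravar; [now apply Rinv_0_lt_compat|lra].
Qed.

Lemma Qf_bound (k : nat) :
  exists M, forall th, exists C, forall eps V,
    controlled M th eps V -> forall x t, 0 < t < 1 -> Rabs (Qf V k x t) <= C.
Proof.
  destruct (transform_bound k) as [M0 H0]. destruct (transform_bound (S (S k))) as [M2 H2].
  exists (max M0 M2). intros th. destruct (H0 th) as [C0 HC0]. destruct (H2 th) as [C2 HC2].
  (* The last summand absorbs the correction eps t in [transform_dt] at k = 0. *)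
  exists (8 * C0 + bd_eps th * C2 + bd_eps th). intros eps V Hc x t It.
  assert (It' : 0 <= t <= 1) by lra.
  pose proof (ct_jet _ _ _ _ Hc) as HV. pose proof (sj_eps _ _ HV) as Hep.
  pose proof (ct_eps _ _ _ _ Hc).
  assert (B0 := HC0 eps V (controlled_le M0 _ _ _ _ (Nat.le_max_l _ _) Hc)).
  assert (B2 := HC2 eps V (controlled_le M2 _ _ _ _ (Nat.le_max_r _ _) Hc)).
  assert (B : Rabs (transform_dt eps V k (slope V x t) t) <= 8 * C0 + eps * C2).
  { apply (harmonic_dt_bound eps C0 C2 _ _ (transform eps V) (transform_dt eps V) k Hep
             (transform_harmonic _ _ HV)); try exact It.
    - intros i y s Is. apply transform_dy; [exact HV|lra].
    - intros i y s Is. now apply transform_dt_dy.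
    - intros y s Is. apply B0. lra.
    - intros y s Is. apply B2. lra. }
  assert (HC2p : 0 <= C2) by (eapply Rle_trans; [apply Rabs_pos|apply (B2 0 t It')]).
  assert (E2 : eps * C2 <= bd_eps th * C2) by (now apply Rmult_le_compat_r).
  destruct k as [|k]; simpl transform_dt in B;
    rewrite (inv_slope_slope _ _ HV) in B by exact It'.
  - change (Qf V 0 x t) with (V O 1%nat x t).
    assert (0 <= eps * t <= eps) by nra.
    apply Rabs_le_between in B. apply Rabs_le. lra.
  - rewrite Rabs_Ropp in B. lra.
Qed.

Lemma higher_derivative_bound (a b : nat) : (2 <= a + 2 * b)%nat ->
  exists M, forall th, exists C, forall eps V,
    controlled M th eps V -> forall x t, 0 < t < 1 -> Rabs (V a b x t) <= C.
Proof.
  intros Hab.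
  destruct (poly_bound (fun M th rho => exists eps V x t,
    controlled M th eps V /\ 0 < t < 1 /\ rho = yenv eps V x t)) with (p := V_poly a b) as [M HM].
  - intros M M' th rho HMM [eps [V [x [t [Hc H]]]]]. exists eps, V, x, t.
    split; [now apply (controlled_le M M')|exact H].
  - intros [k|k| |].
    + destruct (Pf_bound k) as [M HM]. exists M. intros th. destruct (HM th) as [C HC].
      exists C. intros rho [eps [V [x [t [Hc [It ->]]]]]]. apply (HC eps V Hc). lra.
    + destruct (Qf_bound k) as [M HM]. exists M. intros th. destruct (HM th) as [C HC].
      exists C. intros rho [eps [V [x [t [Hc [It ->]]]]]]. now apply (HC eps V Hc).
    + exists 2%nat. intros th. exists (1 + bd_K th).
      intros rho [eps [V [x [t [Hc [It ->]]]]]]. apply (Z_bound th eps); [exact Hc|lra].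
    + exists O. intros th. exists (bd_eps th). intros rho [eps [V [x [t [Hc [It ->]]]]]]. simpl.
      rewrite Rabs_pos_eq; [now apply (ct_eps _ _ _ _ Hc)|].
      left. apply (sj_eps _ _ (ct_jet _ _ _ _ Hc)).
  - exists M. intros th. destruct (HM th) as [C HC]. exists C. intros eps V Hc x t It.
    rewrite (V_poly_correct _ _ (ct_jet _ _ _ _ Hc) a b x t Hab It).
    apply HC. now exists eps, V, x, t.
Qed.

Lemma derivative_bound (a b : nat) :
  exists M, forall th, exists C, forall eps V,
    controlled M th eps V -> forall x t, 0 < t < 1 -> Rabs (V a b x t) <= C.
Proof.
  destruct (le_lt_dec 2 (a + 2 * b)) as [Hab|Hab]; [now apply higher_derivative_bound|].
  replace b with O by lia. destruct a as [|a].
  - destruct (transform_bound 0) as [M HM]. exists M. intros th. destruct (HM th) as [C HC].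
    (* At y = x + u_x the transform [w] gives u = - w - u_x^2 / 2 + eps t^2 / 2. *)
    exists (C + bd_eps th / 2 + 1 / 2). intros eps V Hc x t It.
    pose proof (ct_jet _ _ _ _ Hc) as HV. pose proof (sj_eps _ _ HV).
    pose proof (ct_eps _ _ _ _ Hc). assert (It' : 0 <= t <= 1) by lra.
    specialize (HC eps V Hc (slope V x t) t It'). simpl transform in HC.
    rewrite (inv_slope_slope _ _ HV) in HC by exact It'.
    pose proof (V10_bound _ _ HV x t It') as B1. unfold slope in HC.
    apply Rabs_le_between in B1. apply Rabs_le_between in HC.
    assert (B2 : V 1%nat O x t ^ 2 <= 1) by nra.
    assert (0 <= V 1%nat O x t ^ 2) by apply pow2_ge_0.
    assert (B3 : 0 <= t ^ 2 <= 1) by nra.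
    assert (0 <= eps * t ^ 2 <= eps) by nra.
    apply Rabs_le. lra.
  - replace a with O by lia. exists O. intros th. exists 1. intros eps V Hc x t It.
    apply (V10_bound _ _ (ct_jet _ _ _ _ Hc)). lra.
Qed.

(* No derivative in [t] is known to exist on the boundary; there the value 0 makes [solution_V]
   an [x]-jet on the whole closed strip. *)
Definition solution_V (u : R -> R -> R) (a b : nat) (x t : R) : R :=
  match b with
  | O => partial_derive a 0 u x t
  | S _ => if Rlt_dec 0 t then if Rlt_dec t 1 then partial_derive a b u x t else 0 else 0
  end.

Lemma solution_V_interior (u : R -> R -> R) (a b : nat) (x t : R) :
  0 < t < 1 -> solution_V u a b x t = partial_derive a b u x t.
Proof.
  intros It. destruct b as [|b]; [reflexivity|]. simpl.
  destruct (Rlt_dec 0 t); [|lra]. destruct (Rlt_dec t 1); [reflexivity|lra].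
Qed.

Lemma solution_V_boundary (u : R -> R -> R) (a b : nat) (x t : R) :
  t = 0 \/ t = 1 -> solution_V u a (S b) x t = 0.
Proof.
  intros Ht. simpl. destruct (Rlt_dec 0 t); [|reflexivity].
  destruct (Rlt_dec t 1); [lra|reflexivity].
Qed.

(** Turns semidefiniteness into strict convexity in [x], the determinant being [eps]. *)
Lemma psd2_det_pos (a b d : R) : psd2 a b d -> 0 < d * a - b ^ 2 -> 0 < a.
Proof.
  intros H Hd. pose proof (H 1 0) as H1. destruct (Req_dec a 0) as [->|]; [|lra].
  exfalso. pose proof (pow2_ge_0 b). lra.
Qed.

(** Periodicity reduces [x] to [0,1], where compactness makes continuity up to the boundary
    uniform. *)
Lemma solution_uniform (eps : R) (u0 u1 : R -> R) (u : R -> R -> R) :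
  is_solution eps u0 u1 u ->
  forall e, 0 < e -> exists d, 0 < d /\ forall x s t,
    0 <= s <= 1 -> 0 <= t <= 1 -> Rabs (s - t) < d -> Rabs (u x s - u x t) < e.
Proof.
  intros Hu e He.
  destruct (uniform_continuity_2d (fun x t => u x (clamp t)) 0 1 0 1) with (eps := mkposreal e He)
    as [d Hd].
  - intros x t _ _ q.
    pose proof (sol_continuous _ _ _ _ Hu (x, clamp t) (clamp_range t)) as Hc.
    rewrite filterlim_locally in Hc. destruct (Hc q) as [r Hr]. exists r.
    intros v s Hv Hs. apply (Hr (v, clamp s)); [|apply clamp_range].
    split; [exact Hv|]. eapply Rle_lt_trans; [apply clamp_lipschitz|exact Hs].
  - exists d. split; [apply cond_pos|]. intros x s t Is It Hst.
    destruct (unit_interval_representative x) as [z [n [Iz ->]]].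
    assert (E : forall r, 0 <= r <= 1 -> u (z + IZR n) r = u z (clamp r)).
    { intros r Ir. rewrite clamp_id by exact Ir. apply (periodic_shift (fun x => u x r)).
      intros x. now apply (sol_periodic _ _ _ _ Hu). }
    rewrite !E by assumption. apply Hd; try assumption.
    rewrite Rminus_diag, Rabs_R0. apply cond_pos.
Qed.

Lemma solution_V_jet (eps : R) (u0 u1 : R -> R) (lambda : R) (u : R -> R -> R) :
  0 < lambda -> 0 < eps -> smooth_circle u0 -> smooth_circle u1 ->
  strictly_convex lambda u0 -> strictly_convex lambda u1 ->
  is_solution eps u0 u1 u -> solution_jet eps (solution_V u).
Proof.
  intros Hl Hep [_ S0] [_ S1] C0 C1 Hu.
  assert (E0 : (fun x => u x 0) = u0) by (extensionality x; apply (sol_bottom _ _ _ _ Hu)).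
  assert (E1 : (fun x => u x 1) = u1) by (extensionality x; apply (sol_top _ _ _ _ Hu)).
  assert (Hex : forall a b x t, 0 < t < 1 -> ex_diff_n (partial_derive a b u) 0 x t).
  { intros a b x t It. rewrite <- (Nat.sub_diag (a + b)). apply ex_diff_n_deriv; [lia|].
    now apply (sol_smooth _ _ _ _ Hu). }
  constructor.
  - exact Hep.
  - intros a b x t It.
    destruct (Req_dec t 0) as [->|H0]; [|destruct (Req_dec t 1) as [->|H1]].
    + destruct b as [|b].
      * simpl. unfold partial_derive. simpl. rewrite E0.
        apply Derive_correct. exact (S0 (S a) x).
      * rewrite solution_V_boundary by now left.
        apply (is_derive_ext (fun _ => 0)); [|apply @is_derive_const].
        intros z. now rewrite solution_V_boundary by now left.
    + destruct b as [|b].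
      * simpl. unfold partial_derive. simpl. rewrite E1.
        apply Derive_correct. exact (S1 (S a) x).
      * rewrite solution_V_boundary by now right.
        apply (is_derive_ext (fun _ => 0)); [|apply @is_derive_const].
        intros z. now rewrite solution_V_boundary by now right.
    + assert (It' : 0 < t < 1) by lra.
      rewrite solution_V_interior by exact It'.
      apply (is_derive_ext (fun z => partial_derive a b u z t)).
      { intros z. now rewrite solution_V_interior. }
      apply Derive_correct. apply (ex_diff_n_ex_deriv_inf_1 (S (a + b))); [lia|].
      now apply (sol_smooth _ _ _ _ Hu).
  - intros a b x t It. rewrite solution_V_interior by exact It.
    apply (is_derive_ext_loc (fun s => partial_derive a b u x s)).
    { apply (locally_interval _ t 0 1); try apply It. intros s Hs0 Hs1.
      rewrite solution_V_interior; [reflexivity|split; assumption]. }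
    (* [partial_derive] takes the [t]-derivatives first, so moving d_t past d_x^a is the symmetry of
       mixed derivatives, which needs smoothness in a neighbourhood. *)
    rewrite <- Derive_partial_derive.
    + apply Derive_correct. apply (ex_diff_n_ex_deriv_inf_2 (S (a + b))); [lia|].
      now apply (sol_smooth _ _ _ _ Hu).
    + apply locally_2d_strip; [exact It|]. intros. now apply (sol_smooth _ _ _ _ Hu).
  - intros a b x t It.
    apply (continuity_2d_pt_ext_loc (partial_derive a b u)).
    + apply locally_2d_strip; [exact It|]. intros. now rewrite solution_V_interior.
    + apply (proj1 (Hex a b x t It)).
  - intros x t It. apply (sol_periodic _ _ _ _ Hu x t It).
  - intros x t It.
    destruct (Req_dec t 0) as [->|H0]; [|destruct (Req_dec t 1) as [->|H1]].
    + specialize (C0 x). simpl solution_V. unfold partial_derive.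
      change (fun t => Derive_n (fun z => u t z) 0 0) with (fun x => u x 0). rewrite E0. lra.
    + specialize (C1 x). simpl solution_V. unfold partial_derive.
      change (fun t => Derive_n (fun z => u t z) 0 1) with (fun x => u x 1). rewrite E1. lra.
    + assert (It' : 0 < t < 1) by lra. rewrite Rplus_comm.
      apply (psd2_det_pos _ _ _ (sol_psd _ _ _ _ Hu x t It')).
      rewrite (Rplus_comm _ 1), (sol_equation _ _ _ _ Hu x t It'). exact Hep.
  - intros x t It. rewrite !solution_V_interior by exact It.
    now apply (sol_equation _ _ _ _ Hu).
  - apply (solution_uniform _ _ _ _ Hu).
Qed.

(** * Sup norms and conclusion *)

Lemma sup_norm_ge {T : Type} (D : T -> Prop) (f : T -> R) (p : T) :
  D p -> Rbar_le (Rabs (f p)) (sup_norm D f).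
Proof.
  intros Hp. unfold sup_norm.
  destruct (Lub_Rbar_correct (fun r => exists p, D p /\ r = Rabs (f p))) as [H _].
  apply H. now exists p.
Qed.

Lemma sup_norm_le {T : Type} (D : T -> Prop) (f : T -> R) (C : R) :
  (forall p, D p -> Rabs (f p) <= C) -> Rbar_le (sup_norm D f) C.
Proof.
  intros H. unfold sup_norm.
  destruct (Lub_Rbar_correct (fun r => exists p, D p /\ r = Rabs (f p))) as [_ L].
  apply L. intros r [p [Hp ->]]. now apply H.
Qed.

Lemma CM_norm_bound (M : nat) (f : R -> R) (K : R) :
  Rbar_le (CM_norm M f) K -> forall a x, (a <= M)%nat -> Rabs (Derive_n f a x) <= K.
Proof.
  set (F := fun k => sup_norm (fun _ : R => True) (Derive_n f k)).
  assert (Hge : forall k x, Rbar_le (Rabs (Derive_n f k x)) (F k)).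
  { intros k x. now apply (sup_norm_ge (fun _ => True) (Derive_n f k)). }
  assert (H0 : forall k, Rbar_le 0 (F k)).
  { intros k. eapply Rbar_le_trans; [|apply (Hge k 0)]. apply Rabs_pos. }
  assert (Hs : forall n, Rbar_le 0 (Rbar_sum F n) /\
    forall k, (k <= n)%nat -> Rbar_le (F k) (Rbar_sum F n)).
  { induction n as [|n [IH0 IH]].
    - split; [apply H0|]. intros k Hk. replace k with O by lia. apply Rbar_le_refl.
    - assert (Hl : Rbar_le (Rbar_sum F n) (Rbar_sum F (S n))).
      { rewrite <- (Rbar_plus_0_r (Rbar_sum F n)) at 1.
        apply Rbar_plus_le_compat; [apply Rbar_le_refl|apply H0]. }
      split; [now apply Rbar_le_trans with (Rbar_sum F n)|].
      intros k Hk. destruct (Nat.eq_dec k (S n)) as [->|Hn].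
      + rewrite <- (Rbar_plus_0_l (F (S n))).
        apply Rbar_plus_le_compat; [exact IH0|apply Rbar_le_refl].
      + apply Rbar_le_trans with (Rbar_sum F n); [apply IH; lia|exact Hl]. }
  intros HK a x Ha.
  change (Rbar_le (Rabs (Derive_n f a x)) K).
  eapply Rbar_le_trans; [apply Hge|]. eapply Rbar_le_trans; [|exact HK]. now apply Hs.
Qed.

(** Used twice, for the sum over [b] inside the sum over [a]; each term may ask for its own [M]. *)
Lemma Rbar_sum_uniform_bound {I T : Type} (Good : nat -> T -> I -> Prop) (F : I -> nat -> Rbar) :
  (forall M M' th i, (M <= M')%nat -> Good M' th i -> Good M th i) ->
  (forall k, exists M, forall th, exists C : R, forall i, Good M th i -> Rbar_le (F i k) C) ->
  forall n, exists M, forall th, exists C : R, forall i, Good M th i -> Rbar_le (Rbar_sum (F i) n) C.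
Proof.
  intros Hmon HF. induction n as [|n [M1 H1]]; [apply HF|].
  destruct (HF (S n)) as [M2 H2]. exists (max M1 M2). intros th.
  destruct (H1 th) as [C1 HC1]. destruct (H2 th) as [C2 HC2]. exists (C1 + C2). intros i G.
  apply (Rbar_plus_le_compat _ C1 _ C2); [apply HC1|apply HC2]; (eapply Hmon; [|exact G]; lia).
Qed.

Theorem theorem2 :
  forall N : nat, exists M : nat,
  forall eps0 lambda K : R, 0 < lambda ->
  exists C : R,
  forall (eps : R) (u0 u1 : R -> R) (u : R -> R -> R),
    0 < eps -> eps <= eps0 ->
    smooth_circle u0 -> smooth_circle u1 ->
    strictly_convex lambda u0 -> strictly_convex lambda u1 ->
    Rbar_le (CM_norm M u0) (Finite K) ->
    Rbar_le (CM_norm M u1) (Finite K) ->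
    is_solution eps u0 u1 u ->
    Rbar_le (CN_norm N u) (Finite C).
Proof.
  intros N.
  set (Good := fun M th u => exists eps, controlled M th eps (solution_V u)).
  assert (Hmon : forall M M' th u, (M <= M')%nat -> Good M' th u -> Good M th u).
  { intros M M' th u HM [eps Hc]. exists eps. now apply (controlled_le M M'). }
  assert (H : exists M, forall th, exists C : R, forall u, Good M th u -> Rbar_le (CN_norm N u) C).
  { apply (Rbar_sum_uniform_bound Good (fun u a => Rbar_sum (fun b =>
      sup_norm open_strip (fun p => partial_derive a b u (fst p) (snd p))) (N - a)) Hmon).
    intros a. apply (Rbar_sum_uniform_bound Good (fun u b =>
      sup_norm open_strip (fun p => partial_derive a b u (fst p) (snd p))) Hmon).
    intros b. destruct (derivative_bound a b) as [M HM]. exists M. intros th.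
    destruct (HM th) as [C HC]. exists C. intros u [eps Hc]. apply sup_norm_le.
    intros [x t] It. simpl. rewrite <- solution_V_interior by exact It.
    now apply (HC eps _ Hc). }
  destruct H as [M HM]. exists (max 2 M). intros eps0 lambda K Hl.
  destruct (HM {| bd_eps := eps0; bd_lambda := lambda; bd_K := K |}) as [C HC]. exists C.
  intros eps u0 u1 u Hep He0 S0 S1 C0 C1 K0 K1 Hu. apply HC.
  apply (Hmon M (max 2 M)); [lia|]. exists eps.
  assert (E0 : (fun x => u x 0) = u0) by (extensionality x; apply (sol_bottom _ _ _ _ Hu)).
  assert (E1 : (fun x => u x 1) = u1) by (extensionality x; apply (sol_top _ _ _ _ Hu)).
  assert (V0 : forall a x, solution_V u a 0 x 0 = Derive_n u0 a x) by (rewrite <- E0; reflexivity).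
  assert (V1 : forall a x, solution_V u a 0 x 1 = Derive_n u1 a x) by (rewrite <- E1; reflexivity).
  constructor; simpl bd_eps; simpl bd_lambda; simpl bd_K; try assumption.
  - now apply (solution_V_jet eps u0 u1 lambda).
  - intros x t [-> | ->]; [rewrite V0; specialize (C0 x)|rewrite V1; specialize (C1 x)]; lra.
  - intros a x t [-> | ->] Ha; [rewrite V0|rewrite V1]; now apply (CM_norm_bound (max 2 M)).
  - intros a b x t Ht. now apply solution_V_boundary.
Qed.
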